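(* Let $T$ be an irreducible triangulation of a closed surface other than the sphere $S_0$, let $w_1w_2w_3$ be a nonseparating 3-cycle of $T$, and let $T'$ be the pre-irreducible triangulation obtained from $T$ by the cut/cap operation along $w_1w_2w_3$ (with boundary vertices $u'_1,u'_2,u'_3,v'_1,v'_2,v'_3$ as described in the context). Let $T''$ be a triangulation obtained from $T'$ by contracting zero or more interior edges. Then: (1) every edge of $T''$ is a frame edge, or is not contractible, or lies on a path of length at most 3 connecting $u'_i$ and $v'_i$ for some $i\in\{1,2,3\}$; (2) every vertex of $T''$ is a frame vertex, or lies on a noncontractible edge, or lies both on a path of length at most 3 connecting $u'_i$ and $v'_i$ and on a path of length at most 3 connecting $u'_j$ and $v'_j$ for some $1 \le i < j \le 3$.
   Context: A triangulation of a closed surface is a simple graph embedded in the surface such that each face is a triangle and any two faces share at most one edge. For an edge $ac$ with incident faces $abc$ and $acd$, the contraction of $ac$ deletes $ac$, identifies $a$ and $c$, and removes one of each pair of resulting multiple edges ($ab$/$cb$ and $ad$/$cd$). An edge is contractible if its contraction yields a triangulation of the same surface (for triangulations other than $K_4$ on the sphere, equivalently if it lies on exactly two 3-cycles, namely the two facial ones). A triangulation is irreducible if it has no contractible edges. A 3-cycle embedded as a closed curve $C$ in surface $S$ is nonseparating if $S-C$ is connected; it is one-sided if a neighbourhood of $C$ is a Möbius band, and two-sided otherwise. Cut/cap operation: if $w_1w_2w_3$ is two-sided, cut the surface along it, obtaining two boundary 3-cycles $u'_1u'_2u'_3$ and $v'_1v'_2v'_3$, where $u'_i$ and $v'_i$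 come from $w_i$; cap each hole with a new face $u'_1u'_2u'_3$, resp. $v'_1v'_2v'_3$. If $w_1w_2w_3$ is one-sided, cut along it, obtaining a boundary 6-cycle $u'_1u'_2u'_3v'_1v'_2v'_3$ (again $u'_i,v'_i$ come from $w_i$); cap the hole with a new vertex $t'$ and the six faces $t'u'_1u'_2$, $t'u'_2u'_3$, $t'u'_3v'_1$, $t'v'_1v'_2$, $t'v'_2v'_3$, $t'v'_3u'_1$. The result $T'$ is called a pre-irreducible triangulation. The frame is the subgraph consisting of the vertices and edges of the two added faces (two-sided case) or of the six added faces (one-sided case); its vertices and edges are frame vertices and frame edges. Non-frame vertices are interior vertices; an interior edge is an edge both of whose endpoints are interior vertices. Contracting interior edges leaves the frame (and the labels $u'_i,v'_i$) unchanged. *)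

(* Defs.v *)
From mathcomp Require Import all_boot all_order all_algebra.

Set Implicit Arguments.
Unset Strict Implicit.
Unset Printing Implicit Defensive.

(* A triangulation of a closed surface is represented by its set of faces,
   each face being the set of its three corners.  Its vertices and edges are
   those of its faces, so a vertex of V outside [vertices F] plays no role. *)

Section Triangulations.

Variable V : finType.
Implicit Types (F : {set {set V}}) (x y z a c : V).

Definition vertices F : {set V} := cover F.

Definition adj F x y : bool :=
  (x != y) && [exists f in F, (x \in f) && (y \in f)].

Definition edges F : {set {set V}} :=
  [set e | [exists x, exists y, (e == [set x; y]) && adj F x y]].

(* The link of v: x and y are adjacent in it when vxy is a face. *)
Definition link F v : rel V := fun x y => [set v; x; y] \in F.

(* Two faces on every edge and a connected link at every vertex: every link is
   a cycle, so that the union of the faces is a closed surface. *)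
Definition triangulation F : Prop :=
  [/\ F != set0,
      {in F, forall f : {set V}, #|f| = 3},
      {in edges F, forall e : {set V}, #|[set f in F | e \subset f]| = 2},
      forall v x y, adj F v x -> adj F v y -> connect (link F v) x y
    & {in vertices F &, forall x y, connect (adj F) x y}].

Definition euler_char F : int :=
  (#|vertices F|%:Z - #|edges F|%:Z + #|F|%:Z)%R.

(* [o x y z] says that the face xyz is oriented in the cyclic order (x, y, z);
   coherence: a directed edge (x, y) is followed by at most one face. *)
Definition orientable F : Prop :=
  exists o : V -> V -> V -> bool,
    (forall x y z, [set x; y; z] \in F ->
       o x y z = o y z x /\ o x y z = ~~ o y x z) /\
    (forall x y z t, [set x; y; z] \in F -> [set x; y; t] \in F ->
       o x y z -> o x y t -> z = t).

End Triangulations.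

(* Closed surfaces are identified by their type in the classification: Euler
   characteristic and orientability. *)
Definition same_surface (V W : finType)
    (F : {set {set V}}) (G : {set {set W}}) : Prop :=
  euler_char F = euler_char G /\ (orientable F <-> orientable G).

Definition K4 : {set {set 'I_4}} := [set f : {set 'I_4} | #|f| == 3].

Definition spherical (V : finType) (F : {set {set V}}) : Prop :=
  same_surface F K4.

Section Contractions.

Variable V : finType.
Implicit Types (F G H K : {set {set V}}) (x y a c : V).

(* The vertex resulting from the identification of a and c is called a.  Parallel
   edges are merged because faces are sets of vertices. *)
Definition contract F a c : {set {set V}} :=
  [set [set (if x == c then a else x) | x in f]
     | f : {set V} in F & ~~ ([set a; c] \subset f)].

Definition contractible F a c : Prop :=
  [/\ adj F a c, triangulation (contract F a c)
    & same_surface (contract F a c) F].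

Definition irreducible F : Prop :=
  triangulation F /\ forall a c, ~ contractible F a c.

(* [contractions K G H]: H is obtained from G by successively contracting edges
   both of whose endpoints are interior, i.e., outside the frame given by the
   faces K, every contraction yielding a triangulation of the same surface. *)
Definition interior K G x : bool := (x \in vertices G) && (x \notin vertices K).

Inductive contractions K : {set {set V}} -> {set {set V}} -> Prop :=
| contractions0 G : contractions K G G
| contractionsS G H a c :
    contractions K G H -> interior K H a -> interior K H c ->
    contractible H a c -> contractions K G (contract H a c).

(* Paths of length at most 3 from a to c, as the full sequence of vertices. *)
Definition short_path F a c (q : seq V) : bool :=
  if q is x :: p then
    [&& x == a, last x p == c, path (adj F) x p, uniq q & size p <= 3]
  else false.

Definition edge_on x y (q : seq V) : bool :=
  infix [:: x; y] q || infix [:: y; x] q.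

End Contractions.

Section CutCap.

Variable V : finType.
Implicit Types (F : {set {set V}}) (w : 'I_3 -> V).

Definition i1 : 'I_3 := @Ordinal 3 0 isT.
Definition i2 : 'I_3 := @Ordinal 3 1 isT.
Definition i3 : 'I_3 := @Ordinal 3 2 isT.

Definition three_cycle F w : Prop := forall i j, i != j -> adj F (w i) (w j).

(* In a simple graph, the edges of a 3-cycle are exactly the edges with both
   endpoints on it. *)
Definition on_cycle w (e : {set V}) : bool := e \subset [set w i | i : 'I_3].

(* f and g are faces that share an edge not on the cycle. *)
Definition across F w : rel {set V} := fun f g =>
  [&& f \in F, g \in F, #|f :&: g| == 2 & ~~ on_cycle w (f :&: g)].

(* The complement of the cycle is connected: each edge off the cycle joins its
   two faces, each vertex off the cycle joins the faces around it. *)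
Definition nonseparating F w : Prop :=
  {in F &, forall f g, connect (across F w) f g}.

(* [s f i] is the side of the cycle on which the face f lies locally at w_i: of
   two faces that share an edge at w_i, the sides are equal iff that edge is not
   on the cycle.  Along an edge of the cycle the sides at its two ends agree,
   except that for a one-sided cycle (one = true) they are swapped once, on
   w_3 w_1.  Thus a [side_labelling F w false s] is a coherent choice of sides
   along the whole cycle, i.e., the cycle is two-sided, and a
   [side_labelling F w true s] exhibits a Moebius band around the cycle. *)
Definition side_labelling F w (one : bool) (s : {set V} -> 'I_3 -> bool)
    : Prop :=
  (forall f g i, f \in F -> g \in F -> #|f :&: g| = 2 -> w i \in f :&: g ->
     (s f i == s g i) = ~~ on_cycle w (f :&: g)) /\
  (forall f i j, f \in F -> w i \in f -> w j \in f -> i < j ->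
     s f i (+) s f j = [&& one, i == i1 & j == i3]).

(* The vertices after cutting: the old ones, the two copies of each w_i, and the
   vertex t' that caps the hole in the one-sided case.  The old copy of w_i and,
   in the two-sided case, t' are on no face. *)
Definition cut_vertex : finType := (V + 'I_3 * bool + unit)%type.

Definition old (x : V) : cut_vertex := inl (inl x).
Definition u' (i : 'I_3) : cut_vertex := inl (inr (i, false)).
Definition v' (i : 'I_3) : cut_vertex := inl (inr (i, true)).
Definition t' : cut_vertex := inr tt.

Definition cut_face w (s : {set V} -> 'I_3 -> bool) (f : {set V})
    : {set cut_vertex} :=
  [set (if [pick i | w i == x] is Some i
        then (if s f i then v' i else u' i) else old x) | x in f].

Definition cap (one : bool) : {set {set cut_vertex}} :=
  if one then
    [set [set t'; u' i1; u' i2]] :|: [set [set t'; u' i2; u' i3]]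
    :|: [set [set t'; u' i3; v' i1]] :|: [set [set t'; v' i1; v' i2]]
    :|: [set [set t'; v' i2; v' i3]] :|: [set [set t'; v' i3; u' i1]]
  else
    [set [set u' i1; u' i2; u' i3]] :|: [set [set v' i1; v' i2; v' i3]].

Definition cut_cap F w (one : bool) (s : {set V} -> 'I_3 -> bool)
    : {set {set cut_vertex}} :=
  [set cut_face w s f | f : {set V} in F] :|: cap one.

End CutCap.

Arguments u' {V} i.
Arguments v' {V} i.
Arguments t' {V}.
Arguments cap V one : clear implicits.

(* Main.v *)
Require Import Defs.
From mathcomp Require Import all_boot all_order all_algebra.
From mathcomp Require Import ring.

(* Call an edge good if every 3-cycle through it is facial.  An edge of a
   triangulation other than K_4 is contractible iff it is good, so no edge of T
   is good.  A nonfacial 3-cycle through an edge xy of T either lifts to one in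
   T', or is cut open by the operation into a path of length at most 3 from u'_i
   to v'_i; hence every good nonframe edge of T' lies on such a path.

   This property survives the contraction of an interior edge ac.  If a good edge
   after the contraction was not good before, then a nonfacial 3-cycle D became
   facial, which forces D to bound a disc made of three faces around one endpoint
   o of ac, of degree 3, with the other endpoint on D.  Then ac itself was good,
   hence on a short path, which has to go through o; rerouting it along D covers
   each edge of D.  Part (2) descends in the same way, with o in the role of the
   vertex; in T' itself, an interior vertex all of whose edges are on paths of
   the same index i would share a face with u'_i or v'_i whose third vertex is
   adjacent to both, which cannot happen. *)

Set Implicit Arguments.
Unset Strict Implicit.
Unset Printing Implicit Defensive.

(** * Triangulations as sets of triples *)

Section Faces.
Variable V : finType.
Implicit Types (F : {set {set V}}) (x y z a c : V).

(** Of the two implications between good and contractible, T'' needs only that a contractible edge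
    is good; this follows from local counting and has no exception, not even K_4. The converse is
    used for T alone, so that Euler characteristic and orientability are followed through a single
    contraction, of an edge of T.

    The obstacle in T' is the frame: no claim is made about the links of frame vertices, and T' is
    never shown to be a triangulation. What is available is regularity at interior vertices, two
    faces on each edge between two boundary vertices, and an interior end of each nonframe edge. The
    lemmas that apply to T' are therefore stated under local hypotheses at a and c. After the first
    contraction the complex is a triangulation by the definition of [contractible].

    The bound 3 enters twice: an edge with both ends interior can only be the middle edge of a short
    path between frame vertices, and every inner vertex of a short path is next to one of its
    ends. *)

Lemma set3C x y z : [set x; y; z] = [set y; x; z].
Proof. by rewrite (setUC [set x]). Qed.

Lemma set3AC x y z : [set x; y; z] = [set x; z; y].
Proof. by rewrite setUAC. Qed.

Lemma set3_rot x y z : [set x; y; z] = [set y; z; x].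
Proof. by rewrite set3C set3AC. Qed.

Lemma card_set3 x y z : #|[set x; y; z]| = 3 <-> [/\ x != y, x != z & y != z].
Proof.
rewrite -setUA !cardsU1 cards1 !inE negb_or.
by case: (x == y); case: (x == z); case: (y == z); split => // -[].
Qed.

Definition thirds F x y := [set z | [set x; y; z] \in F].

Lemma thirdsC F x y : thirds F x y = thirds F y x.
Proof. by apply/setP=> z; rewrite !inE set3C. Qed.

Lemma link_sym F x : symmetric (link F x).
Proof. by move=> y z; rewrite /link set3AC. Qed.

Lemma adj_sym F x y : adj F x y = adj F y x.
Proof.
by rewrite /adj eq_sym; congr andb; apply: eq_existsb => f; congr andb; apply: andbC.
Qed.

Lemma adj_irr F x : adj F x x = false.
Proof. by rewrite /adj eqxx. Qed.

Lemma adj_neq F x y : adj F x y -> x != y.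
Proof. by case/andP. Qed.

Lemma adj_face F f x y : f \in F -> x \in f -> y \in f -> x != y -> adj F x y.
Proof.
move=> fF xf yf xy; rewrite /adj xy; apply/existsP; exists f.
by rewrite fF xf yf.
Qed.

Lemma adj_vertex F x y : adj F x y -> x \in vertices F.
Proof.
case/andP=> _ /existsP[f /andP[fF /andP[xf _]]].
by apply/bigcupP; exists f.
Qed.

Definition only_triangles F := {in F, forall f : {set V}, #|f| = 3}.

Section Triangles.
Variable F : {set {set V}}.
Hypothesis F3 : only_triangles F.

Lemma tri_neq x y z : [set x; y; z] \in F -> [/\ x != y, x != z & y != z].
Proof. by move/F3/card_set3. Qed.

Lemma tri_adj x y z : [set x; y; z] \in F ->
  [/\ adj F x y, adj F x z & adj F y z].
Proof.
move=> f; have [xy xz yz] := tri_neq f.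
by split; apply: (adj_face f); rewrite ?inE ?eqxx ?orbT.
Qed.

Lemma face_third f x y : f \in F -> x \in f -> y \in f -> x != y ->
  exists z, f = [set x; y; z].
Proof.
move=> fF xf yf xy; have c3 := F3 fF.
have sub : [set x; y] \subset f by apply/subsetP=> t /set2P[]->.
have : #|f :\: [set x; y]| = 1 by rewrite cardsD (setIidPr sub) cards2 xy c3.
case/eqP/cards1P=> z fz; exists z.
by rewrite -(setID f [set x; y]) (setIidPr sub) fz.
Qed.

Lemma adjP3 x y : reflect (exists z, [set x; y; z] \in F) (adj F x y).
Proof.
apply: (iffP idP) => [/andP[xy /existsP[f /andP[fF /andP[xf yf]]]]|[z f]].
  by have [z fz] := face_third fF xf yf xy; exists z; rewrite -fz.
by case: (tri_adj f).
Qed.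

Lemma card_faces_thirds x y : x != y ->
  #|[set f in F | [set x; y] \subset f]| = #|thirds F x y|.
Proof.
move=> xy; rewrite -(@card_in_imset _ _ (fun z => [set x; y; z])); last first.
  move=> z t; rewrite !inE => /tri_neq[_ xz yz] _ /setP/(_ z).
  by rewrite !inE eqxx orbT eq_sym (negPf xz) eq_sym (negPf yz) => /esym/eqP.
congr #|pred_of_set _|; apply/setP=> f; rewrite !inE; apply/andP/imsetP.
  case=> fF /subsetP sub.
  have [||z fz] := face_third fF _ _ xy; try by apply: sub; rewrite !inE eqxx ?orbT.
  by exists z; rewrite ?inE -?fz.
case=> z; rewrite inE => zF ->; split=> //.
by apply/subsetP=> t; rewrite !inE => ->.
Qed.

Lemma edgesE : edges F = [set e : {set V} | (#|e| == 2) && [exists f in F, e \subset f]].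
Proof.
apply/setP=> e; rewrite !inE; apply/existsP/andP.
  case=> x /existsP[y /andP[/eqP-> /andP[xy /existsP[f /andP[fF /andP[xf yf]]]]]].
  rewrite cards2 xy; split=> //; apply/existsP; exists f; rewrite fF /=.
  by apply/subsetP=> t /set2P[]->.
case=> /cards2P[x [y [xy ->]]] /existsP[f /andP[fF /subsetP sub]].
exists x; apply/existsP; exists y; rewrite eqxx /=.
by apply: (adj_face fF) => //; apply: sub; rewrite !inE eqxx ?orbT.
Qed.

Lemma adj_edge x y : adj F x y -> [set x; y] \in edges F.
Proof.
by move=> xy; rewrite inE; apply/existsP; exists x; apply/existsP; exists y; rewrite eqxx.
Qed.

(** Counts the pairs of an edge inside a face. The number of edges lost in a contraction can then be
    read off from the number of faces lost. *)
Lemma double_counting :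
  (forall x y, adj F x y -> #|thirds F x y| = 2) -> #|F| * 3 = #|edges F| * 2.
Proof.
move=> th2; rewrite -!sum_nat_const.
transitivity (\sum_(f in F) #|[set e in edges F | e \subset f]|).
  apply: eq_bigr => f fF; rewrite -[3]/('C(3, 2)) -(F3 fF) -cards_draws.
  congr #|pred_of_set _|; apply/setP=> e; rewrite edgesE !inE andbC.
  case ef: (e \subset f); rewrite ?andbF ?andbT //.
  by case: (#|e| == 2) => //=; apply/esym/existsP; exists f; rewrite fF.
transitivity (\sum_(e in edges F) #|[set f in F | e \subset f]|).
  under eq_bigr do rewrite -sum1dep_card big_mkcondr /=.
  rewrite exchange_big /=; apply: eq_bigr => e eE.
  by rewrite -sum1dep_card big_mkcondr.
apply: eq_bigr => e; rewrite inE => /existsP[x /existsP[y /andP[/eqP-> xy]]].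
by rewrite (card_faces_thirds (adj_neq xy)) th2.
Qed.

End Triangles.

(** The part of [triangulation] that concerns one vertex, separated because in T' it is established
    only at interior vertices. *)
Definition regular_at F x :=
  (forall y, adj F x y -> #|thirds F x y| = 2) /\
  (forall y z, adj F x y -> adj F x z -> connect (link F x) y z).

Lemma triangulation_regular F x : triangulation F -> regular_at F x.
Proof.
case=> _ F3 E2 L _; split=> [y xy|y z]; last exact: L.
by rewrite -(card_faces_thirds F3 (adj_neq xy)) E2 // adj_edge.
Qed.

Lemma triangulation_intro F :
  F != set0 -> only_triangles F -> (forall x, regular_at F x) ->
  {in vertices F &, forall x y, connect (adj F) x y} -> triangulation F.
Proof.
move=> F0 F3 R C; split=> // [e|v x y vx vy]; last by case: (R v) => _; apply.
rewrite inE => /existsP[x /existsP[y /andP[/eqP-> xy]]].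
by rewrite (card_faces_thirds F3 (adj_neq xy)); case: (R x) => ->.
Qed.

(** The good edges of the overview, with adjacency of x and y left out. As a boolean, its failure
    produces a nonfacial 3-cycle. *)
Definition cycles_facial F x y :=
  [forall z, adj F x z && adj F y z ==> ([set x; y; z] \in F)].

Lemma cycles_facialP F x y :
  reflect (forall z, adj F x z -> adj F y z -> [set x; y; z] \in F)
          (cycles_facial F x y).
Proof.
apply: (iffP forallP) => H z; first by move=> xz yz; apply: (implyP (H z)); rewrite xz.
by apply/implyP=> /andP[]; apply: H.
Qed.

Lemma cycles_facialC F x y : cycles_facial F x y = cycles_facial F y x.
Proof. by apply: eq_forallb => z; rewrite andbC set3C. Qed.

Lemma cycles_facialPn F x y : ~~ cycles_facial F x y ->
  exists z, [/\ adj F x z, adj F y z & [set x; y; z] \notin F].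
Proof.
by rewrite negb_forall => /existsP[z]; rewrite negb_imply => /andP[/andP[]]; exists z.
Qed.

Definition glue a c x := if x == c then a else x.

(* A left inverse of [glue a c] on the faces through c that avoid a. *)
Definition unglue a c x := if x == a then c else x.

Lemma glue_neq a c x : a != c -> glue a c x != c.
Proof. by rewrite /glue => ac; case: (x =P c) => // /eqP. Qed.

Lemma glue_id a c x : x != c -> glue a c x = x.
Proof. by rewrite /glue => /negPf->. Qed.

Lemma imset3 (W : finType) (h : V -> W) x y z :
  h @: [set x; y; z] = [set h x; h y; h z].
Proof. by rewrite !imsetU !imset_set1. Qed.

(** A surviving face does not contain both a and c. If it avoids c it is unchanged; if it contains c
    it avoids a, and [unglue] recovers it. *)
Lemma mem_contract F a c x y z : a != c ->
  ([set x; y; z] \in contract F a c) =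
  [&& x != c, y != c, z != c &
     ([set x; y; z] \in F) ||
     ([set unglue a c x; unglue a c y; unglue a c z] \in F)].
Proof.
move=> ac; have ca : c != a by rewrite eq_sym.
apply/imsetP/idP => [[f]|].
  rewrite inE => /andP[fF nac] E.
  have nc t : t \in [set x; y; z] -> t != c.
    by rewrite E => /imsetP[s _ ->]; apply: glue_neq.
  rewrite !nc ?inE ?eqxx ?orbT //=.
  case cf: (c \in f); last first.
    suff <- : f = [set x; y; z] by rewrite fF.
    rewrite E; apply/setP=> t; apply/idP/imsetP=> [tf|[s sf ->]].
      by exists t => //; case: eqP tf => // ->; rewrite cf.
    by case: eqP => // sc; rewrite -sc sf in cf.
  have af : a \notin f.
    by apply: contra nac => af; apply/subsetP=> t /set2P[]->.
  suff <- : f = [set unglue a c x; unglue a c y; unglue a c z] by rewrite fF orbT.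
  rewrite -imset3 E -imset_comp -[LHS]imset_id; apply: eq_in_imset => t tf /=.
  rewrite /unglue; case: (t =P c) => [->|_]; first by rewrite eqxx.
  by case: eqP tf => // ->; rewrite (negPf af).
case/and4P=> xc yc zc /orP[fF|fF].
  exists [set x; y; z].
    rewrite inE fF; apply/negP=> /subsetP/(_ c).
    by rewrite !inE eqxx orbT ![c == _]eq_sym (negPf xc) (negPf yc) (negPf zc) => /(_ isT).
  by rewrite /= imset3 (negPf xc) (negPf yc) (negPf zc).
have um t : t != c -> (if unglue a c t == c then a else unglue a c t) = t.
  by move=> tc; rewrite /unglue; case: (t =P a) => [->|_]; rewrite ?eqxx // (negPf tc).
have ua t : (a == unglue a c t) = false.
  by rewrite /unglue; case: (t =P a) => [_|/eqP]; rewrite ?(negPf ac) // eq_sym => /negPf.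
exists [set unglue a c x; unglue a c y; unglue a c z]; last by rewrite /= imset3 !um.
by rewrite inE fF; apply/negP=> /subsetP/(_ a); rewrite !inE !ua eqxx => /(_ isT).
Qed.

End Faces.

Lemma card2_eq (T : finType) (A : {set T}) x y :
  #|A| = 2 -> x \in A -> y \in A -> x != y -> A = [set x; y].
Proof.
move=> cA xA yA xy; apply/esym/eqP; rewrite eqEcard cA cards2 xy andbT.
by apply/subsetP=> t /set2P[]->.
Qed.

(** * Faces and edges of a contraction *)

Section Contract.
Variables (V : finType) (F : {set {set V}}) (a c : V).
Hypotheses (F3 : only_triangles F) (ac : a != c).
Implicit Types (x y z p : V).

Lemma glue_eq x y : glue a c x = glue a c y ->
  [\/ x = y, x = a /\ y = c | x = c /\ y = a].
Proof.
rewrite /glue; case: (x =P c) => ex; case: (y =P c) => ey e.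
- by constructor 1; rewrite ex ey.
- by constructor 3.
- by constructor 2.
by constructor 1.
Qed.

Lemma contract_face x y z : [set x; y; z] \in F ->
  glue a c x != glue a c y -> glue a c x != glue a c z ->
  glue a c y != glue a c z ->
  [set glue a c x; glue a c y; glue a c z] \in contract F a c.
Proof.
move=> f xy xz yz; apply/imsetP; exists [set x; y; z]; last by rewrite imset3.
rewrite inE f; apply/negP=> /subsetP sub.
have := sub a; have := sub c; rewrite !inE !eqxx ?orbT => /(_ isT) C /(_ isT) A.
have mac : glue a c a = glue a c c by rewrite /glue eqxx (negPf ac).
case/orP: A => [/orP[]|] /eqP A; case/orP: C => [/orP[]|] /eqP C;
  move: xy xz yz ac mac; rewrite A C => xy xz yz xx e;
  by move: xy xz yz xx; rewrite ?e ?eqxx.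
Qed.

Lemma adj_contract_lift x y : adj (contract F a c) x y ->
  exists x0 y0, [/\ adj F x0 y0, glue a c x0 = x & glue a c y0 = y].
Proof.
case/andP=> xy /existsP[_ /andP[/imsetP[f fF ->] /andP[/imsetP[x0 xf ex] /imsetP[y0 yf ey]]]].
move: fF; rewrite inE => /andP[fF _]; exists x0, y0; split=> //.
by apply: (adj_face fF) => //; apply: contra xy => /eqP e; rewrite ex ey e.
Qed.

(** The edges az and cz become one and pool their third vertices; a and c drop out with the face
    acz, if there is one. *)
Lemma thirds_contract_merged z : z != a -> z != c ->
  thirds (contract F a c) a z = (thirds F a z :|: thirds F c z) :\ a :\ c.
Proof.
move=> za zc; apply/setP=> p; rewrite !inE mem_contract // ac zc /=.
rewrite {1 2}/unglue eqxx (negPf za); case: (p =P a) => [->|pa].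
  rewrite andbF; apply/negP=> /andP[_ /orP[]] /(tri_neq F3)[]; rewrite ?eqxx //.
  by rewrite /unglue !eqxx.
by rewrite /unglue; move/eqP/negPf: pa => ->.
Qed.

Lemma thirds_contract_unmerged x z : x != a -> x != c -> z != a -> z != c ->
  thirds (contract F a c) x z = glue a c @: thirds F x z.
Proof.
move=> xa xc za zc; apply/setP=> p; rewrite !inE mem_contract // xc zc /=.
rewrite {1 2}/unglue (negPf xa) (negPf za); apply/andP/imsetP.
  case=> pc /orP[f|f]; eexists; rewrite ?inE; try exact: f; rewrite /glue.
    by rewrite (negPf pc).
  by rewrite /unglue; case: (p =P a) => [->|]; rewrite ?eqxx ?(negPf pc).
case=> q; rewrite inE => f ->; rewrite glue_neq //; split=> //.
rewrite /glue /unglue; case: (q =P c) => [<-|_]; rewrite ?eqxx ?f ?orbT //.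
Qed.

(** An edge survives if one of its faces does. At an endpoint of ac one face of the edge may be
    deleted together with ac, so a second face is needed there. *)
Lemma adj_contract x y :
  (forall z, adj F a z -> #|thirds F a z| = 2) ->
  (forall z, adj F c z -> #|thirds F c z| = 2) ->
  adj F x y -> glue a c x != glue a c y ->
  adj (contract F a c) (glue a c x) (glue a c y).
Proof.
have mac : glue a c a = glue a c c by rewrite /glue eqxx (negPf ac).
move=> Ra Rc.
suff H u v : adj F u v -> (v != a) && (v != c) -> glue a c u != glue a c v ->
    adj (contract F a c) (glue a c u) (glue a c v).
  move=> xy mxy; case yi: ((y != a) && (y != c)); first exact: H.
  case xi: ((x != a) && (x != c)).
    by rewrite adj_sym; apply: H => //; rewrite 1?adj_sym // eq_sym.
  case/negP: mxy; move/negbT: xi; move/negbT: yi; rewrite !negb_and !negbK.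
  by case/orP=> /eqP-> /orP[]/eqP->; rewrite ?mac.
move=> uv /andP[va vc] muv.
have [p [f pa pc]] : exists p, [/\ [set u; v; p] \in F, glue a c p != glue a c u & p != v].
  case: (boolP ((u == a) || (u == c))) => [ui|].
    have c2 : #|thirds F u v| = 2 by case/orP: ui uv => /eqP->; [apply: Ra | apply: Rc].
    (* Both third vertices differ from u, which is a or c, so at most one of them is in {a, c}. *)
    have /card_gt0P[p] : 0 < #|thirds F u v :\: [set a; c]|.
      rewrite cardsD c2 subn_gt0 ltnS.
      have sub : thirds F u v :&: [set a; c] \subset [set a; c] :\ u.
        apply/subsetP=> t; rewrite 2!inE => /andP[/(tri_neq F3)[_ ut _] tac].
        by rewrite in_setD1 eq_sym ut.
      apply: leq_trans (subset_leq_card sub) _.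
      have uac : u \in [set a; c] by rewrite !inE.
      by have := cards2 a c; rewrite (cardsD1 u) uac ac => -[]; rewrite add0n => ->.
    rewrite !inE negb_or => /andP[/andP[pa pc] f]; exists p.
    have [_ up vp] := tri_neq F3 f.
    rewrite (eq_sym p v) vp; split=> //; apply/eqP=> /glue_eq[]e; first by rewrite e eqxx in up.
      by case: e pa => -> ; rewrite eqxx.
    by case: e pc => -> ; rewrite eqxx.
  rewrite negb_or => /andP[ua uc]; have [p f] := adjP3 F3 _ _ uv.
  have [_ up vp] := tri_neq F3 f.
  exists p; rewrite (eq_sym p v) vp; split=> //; apply/eqP=> /glue_eq[]e.
  - by rewrite e eqxx in up.
  - by case: e uc => _ ->; rewrite eqxx.
  by case: e ua => _ ->; rewrite eqxx.
have mvp : glue a c v != glue a c p.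
  apply/eqP=> /glue_eq[]e; first by rewrite e eqxx in pc.
    by case: e va => ->; rewrite eqxx.
  by case: e vc => ->; rewrite eqxx.
rewrite eq_sym in pa; have g := contract_face f muv pa mvp.
by apply: (adj_face g); rewrite ?inE ?eqxx ?orbT.
Qed.

(* A common neighbour z of a and c with acz not a face would, after the
   contraction, have the four faces of az and cz on the edge az; so these
   coincide in pairs, which propagates the property from z along the whole link
   of a (or c), up to c (or a) itself. *)
Lemma contract_cycles_facial :
  adj F a c ->
  (forall z, adj F a z -> adj F c z ->
     #|thirds F a z| = 2 /\ #|thirds F c z| = 2) ->
  (forall y z, adj F a y -> adj F a z -> connect (link F a) y z) \/
  (forall y z, adj F c y -> adj F c z -> connect (link F c) y z) ->
  triangulation (contract F a c) -> cycles_facial F a c.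
Proof.
move=> adjac E2 L TC; apply/cycles_facialP=> z az cz.
apply: contraT => nacz.
have C3 : only_triangles (contract F a c) by case: TC.
pose N z := [/\ adj F a z, adj F c z & [set a; c; z] \notin F].
have N2 y : N y -> thirds F a y = thirds F c y.
  case=> ay cy nf; have [c2a c2c] := E2 _ ay cy.
  have ya : y != a by rewrite eq_sym (adj_neq ay).
  have yc : y != c by rewrite eq_sym (adj_neq cy).
  have [p f] := adjP3 F3 _ _ ay.
  have U : thirds (contract F a c) a y = thirds F a y :|: thirds F c y.
    rewrite thirds_contract_merged //; apply/setP=> t; rewrite !inE.
    case: (t =P a) => [->|_].
      rewrite andbF; apply/esym/negP=> /orP[/(tri_neq F3)[]|f']; first by rewrite eqxx.
      by rewrite set3AC set3C in f'; rewrite f' in nf.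
    case: (t =P c) => [->|_] //=.
    apply/esym/negP=> /orP[f'|/(tri_neq F3)[]]; last by rewrite eqxx.
    by rewrite set3AC f' in nf.
  have c2 : #|thirds F a y :|: thirds F c y| = 2.
    rewrite -U; have [-> //] := triangulation_regular a TC.
    have : p \in thirds (contract F a c) a y by rewrite U !inE f.
    by rewrite inE => /(tri_adj C3)[].
  have e1 : thirds F a y = thirds F a y :|: thirds F c y.
    by apply/eqP; rewrite eqEcard subsetUl c2 c2a.
  rewrite e1; apply/esym/eqP; rewrite eqEcard subsetUr c2 c2c //.
have NN y p : N y -> p \in thirds F a y -> N p.
  move=> Ny pt; have [ay cy nf] := Ny; move: (pt); rewrite N2 // => ptc.
  move: pt ptc; rewrite !inE => f g.
  have [_ ap yp] := tri_adj F3 f; have [_ cp _] := tri_adj F3 g; split=> //.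
  (* If acp were a face, y would be the only third vertex left on the edge ap after the contraction:
     one face instead of two. *)
  apply/negP=> h; have [c2a c2c] := E2 _ ap cp.
  have yc := adj_neq cy; have ya := adj_neq ay.
  have ea : thirds F a p = [set y; c].
    by apply: card2_eq; rewrite ?inE 1?eq_sym // set3AC.
  have ec : thirds F c p = [set y; a].
    by apply: card2_eq; rewrite ?inE 1?eq_sym // 1?set3AC // (set3C c a).
  have pa := adj_neq ap; have pc := adj_neq cp.
  have := @thirds_contract_merged p; rewrite eq_sym pa eq_sym pc => /(_ isT isT).
  rewrite ea ec.
  have -> : ([set y; c] :|: [set y; a]) :\ a :\ c = [set y].
    apply/setP=> t; rewrite !inE; case: (t =P y) => [->|_] /=.
      by rewrite eq_sym yc eq_sym ya.
    by case: (t =P c) => //=; case: (t =P a).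
  move=> e1.
  have: #|thirds (contract F a c) a p| = 2.
    have [-> //] := triangulation_regular a TC.
    have : y \in thirds (contract F a c) a p by rewrite e1 inE.
    by rewrite inE => /(tri_adj C3)[].
  by rewrite e1 cards1.
have Nz : N z by [].
case: L => [L|L].
  suff [_ cc _] : N c by rewrite adj_irr in cc.
  have /connectP[q] := L _ _ az adjac.
  elim: q z Nz {az cz nacz} => [|p q IH] y Ny /=; first by move=> _ ->.
  case/andP=> yp; apply: IH; apply: (NN y); by rewrite ?inE.
suff [aa _ _] : N a by rewrite adj_irr in aa.
have /connectP[q] := L _ _ cz (etrans (adj_sym _ _ _) adjac).
elim: q z Nz {az cz nacz} => [|p q IH] y Ny /=; first by move=> _ ->.
case/andP=> yp; apply: IH; apply: (NN y); by rewrite ?N2 ?inE.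
Qed.

End Contract.

(** * Short paths and collapsing 3-cycles *)

Section ShortPaths.
Variable V : finType.
Implicit Types (F : {set {set V}}) (u v x y m n : V) (q : seq V).

Definition edge_on_short_path F u v x y :=
  exists q, short_path F u v q /\ edge_on x y q.

Definition vertex_on_short_path F u v x :=
  exists q, short_path F u v q /\ x \in q.

Lemma edge_onC x y q : edge_on x y q = edge_on y x q.
Proof. exact: orbC. Qed.

Lemma edge_on1 x y v : edge_on x y [:: v] = false.
Proof. by rewrite /edge_on /= !andbF. Qed.

Lemma edge_on_cons x y u v q : edge_on x y [:: u, v & q] =
  [|| (x == u) && (y == v), (x == v) && (y == u) | edge_on x y (v :: q)].
Proof.
rewrite /edge_on /= prefix0s !andbT (andbC (y == u)).
by case: ((x == u) && _); case: ((x == v) && (y == u)); rewrite ?orbT ?orbF.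
Qed.

Lemma edge_on_short_pathC F u v x y :
  edge_on_short_path F u v x y -> edge_on_short_path F u v y x.
Proof. by case=> q; rewrite edge_onC; exists q. Qed.

Lemma short_path1 F u v : adj F u v -> short_path F u v [:: u; v].
Proof. by move=> uv; rewrite /short_path /= !eqxx uv !inE (adj_neq uv). Qed.

Lemma short_path2 F u m v : adj F u m -> adj F m v -> u != v ->
  short_path F u v [:: u; m; v].
Proof.
move=> um mv uv.
by rewrite /short_path /= !eqxx um mv !inE negb_or (adj_neq um) (adj_neq mv) uv.
Qed.

Lemma short_path3 F u m n v : adj F u m -> adj F m n -> adj F n v ->
  u != n -> u != v -> m != v -> short_path F u v [:: u; m; n; v].
Proof.
move=> um mn nv u_n uv mv.
rewrite /short_path /= !eqxx um mn nv !inE !negb_or.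
by rewrite (adj_neq um) (adj_neq mn) (adj_neq nv) u_n uv mv.
Qed.

Lemma short_pathP F u v q : u != v -> short_path F u v q ->
  [\/ adj F u v /\ q = [:: u; v],
      exists m, [/\ adj F u m, adj F m v & q = [:: u; m; v]]
    | exists m n, [/\ [/\ adj F u m, adj F m n & adj F n v],
                      u != n, m != v & q = [:: u; m; n; v]]].
Proof.
move=> uv; case: q => [//|x p] /and5P[/eqP-> {x}].
case: p => [|y [|m [|n [|? p]]]] /=; last by rewrite !ltnS.
- by move/eqP=> eu; rewrite eu eqxx in uv.
- by move=> /eqP-> /andP[uy _] _ _; constructor 1.
- by move=> /eqP-> /and3P[uy yv _] _ _; constructor 2; exists y.
move=> /eqP-> /and4P[uy ym mv _]; rewrite !inE !negb_or !andbT.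
move=> /and3P[/and3P[_ um _] /andP[_ yv] _] _.
by constructor 3; exists y, m.
Qed.

Lemma edge_on_short_path_rev F u v x y : u != v ->
  edge_on_short_path F u v x y -> edge_on_short_path F v u x y.
Proof.
move=> uv [q [sq xyq]]; have vu : v != u by rewrite eq_sym.
case: (short_pathP uv sq) xyq => [[uv' ->]|[m [um mv ->]]|[m [n [[um mn nv] u_n mv ->]]]].
- exists [:: v; u]; split; first by rewrite short_path1 // adj_sym.
  by move: xyq; rewrite !edge_on_cons !edge_on1 !orbF orbC.
- exists [:: v; m; u]; split; first by rewrite short_path2 // adj_sym.
  move: xyq; rewrite !edge_on_cons !edge_on1 !orbF.
  by case/or4P=> ->; rewrite ?orbT.
exists [:: v; n; m; u]; split; first by rewrite short_path3 // 1?adj_sym 1?eq_sym.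
move: xyq; rewrite !edge_on_cons !edge_on1 !orbF.
by case/or4P=> [->|->|->|/or3P[]->]; rewrite ?orbT.
Qed.

(** A path with at most three edges has at most two inner vertices, each next to an end. *)
Lemma vertex_on_short_path_adj F u v x : u != v ->
  vertex_on_short_path F u v x -> x != u -> x != v -> adj F x u \/ adj F x v.
Proof.
move=> uv [q [sq xq]] xu xv.
case: (short_pathP uv sq) xq => [[uv' ->]|[m [um mv ->]]|[m [n [[um mn nv] u_n mv ->]]]];
  rewrite !inE (negPf xu) (negPf xv) ?orbF //=.
- by move/eqP->; right.
by case/orP=> /eqP->; [left; rewrite adj_sym | right].
Qed.

(* If a triangle pqr passes through the end q, and p is next to the other end,
   then one of the paths q p v, q r p v goes along any given side. *)
Lemma edge_on_short_path_triangle F (p q r v x y : V) :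
  adj F p q -> adj F p r -> adj F q r -> adj F p v -> q != v ->
  x \in [set p; q; r] -> y \in [set p; q; r] -> x != y ->
  edge_on_short_path F q v x y.
Proof.
move=> pq pr qr pv qv.
have sp : short_path F q v [:: q; p; v] by rewrite short_path2 // adj_sym.
have E1 : edge_on_short_path F q v p q.
  by exists [:: q; p; v]; split=> //; rewrite !edge_on_cons !eqxx ?orbT.
suff [E2 E3] : edge_on_short_path F q v p r /\ edge_on_short_path F q v q r.
  rewrite !inE -!orbA => /or3P[]/eqP-> /or3P[]/eqP->; rewrite ?eqxx // => _ //;
  exact: edge_on_short_pathC.
case: (r =P v) => [rv|/eqP rv].
  split; first by exists [:: q; p; v]; split=> //; rewrite rv !edge_on_cons !eqxx ?orbT.
  by exists [:: q; v]; split; rewrite ?short_path1 // -?rv // !edge_on_cons !eqxx.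
have sr : short_path F q v [:: q; r; p; v].
  by apply: short_path3; rewrite // 1?adj_sym // eq_sym (adj_neq pq).
by split; exists [:: q; r; p; v]; split=> //; rewrite !edge_on_cons !eqxx ?orbT.
Qed.

End ShortPaths.

Section Collapse.
Variables (V : finType) (F : {set {set V}}).
Hypothesis F3 : only_triangles F.
Implicit Types (x y z a c o p q r u v : V).

(** The edges op, oq and or already have their two faces each, so p, q, r form a closed part of the
    connected link of o. *)
Lemma degree3 o p q r y : regular_at F o ->
  [set o; p; q] \in F -> [set o; p; r] \in F -> [set o; q; r] \in F ->
  adj F o y -> y \in [set p; q; r].
Proof.
move=> [t2 L] opq opr oqr oy.
have [op oq pq] := tri_adj F3 opq; have [_ or pr] := tri_adj F3 opr.
have [_ _ qr] := tri_adj F3 oqr.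
have tp : thirds F o p = [set q; r].
  by apply: card2_eq; rewrite ?t2 ?inE // (adj_neq qr).
have tq : thirds F o q = [set p; r].
  by apply: card2_eq; rewrite ?t2 ?inE ?(adj_neq pr) // set3AC.
have tr : thirds F o r = [set p; q].
  by apply: card2_eq; rewrite ?t2 ?inE ?(adj_neq pq) // set3AC.
have /connectP[s] := L _ _ op oy.
have: p \in [set p; q; r] by rewrite !inE eqxx.
have N x z : x \in [set p; q; r] -> link F o x z -> z \in [set p; q; r].
  rewrite /link !inE -orbA => /or3P[]/eqP-> f.
  - by have: z \in thirds F o p by [rewrite inE]; rewrite tp !inE => /orP[]->; rewrite ?orbT.
  - by have: z \in thirds F o q by [rewrite inE]; rewrite tq !inE => /orP[]->; rewrite ?orbT.
  by have: z \in thirds F o r by [rewrite inE]; rewrite tr !inE => /orP[]->; rewrite ?orbT.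
elim: s {1 3 4}p => [|z s IH] x xt /=; first by move=> _ ->.
by case/andP=> xz; apply: IH; apply: N xt xz.
Qed.

Lemma degree3_cycles_facial o p q r y : regular_at F o ->
  [set o; p; q] \in F -> [set o; p; r] \in F -> [set o; q; r] \in F ->
  adj F o y -> cycles_facial F o y.
Proof.
move=> R opq opr oqr oy; apply/cycles_facialP=> z oz /adj_neq.
have := degree3 R opq opr oqr oz; have := degree3 R opq opr oqr oy.
rewrite !inE -!orbA => /or3P[]/eqP-> /or3P[]/eqP->; rewrite ?eqxx // => _;
  by rewrite // set3AC.
Qed.

Section Step.
Variables a c : V.
Hypotheses (ac : adj F a c) (ra : regular_at F a) (rc : regular_at F c).
Hypothesis lac : cycles_facial F a c.
Let a_neq_c := adj_neq ac.
Local Notation F' := (contract F a c).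
Local Notation h := (glue a c).

(* A nonfacial 3-cycle that becomes facial bounds, in F, a disc made of the
   three faces around a vertex o of degree 3, an endpoint of ac. *)
Lemma nonfacial_collapse x y z :
  adj F x y -> adj F x z -> adj F y z -> [set x; y; z] \notin F ->
  cycles_facial F' (h x) (h y) ->
  exists o p q r, [/\ o = a /\ p = c \/ o = c /\ p = a,
    [set o; p; q] \in F, [set o; p; r] \in F, [set o; q; r] \in F
    & [set x; y; z] = [set p; q; r]].
Proof.
(* Two vertices of the 3-cycle can be identified only if they are a and c, but all 3-cycles through
   ac are facial. *)
have D s t r : adj F s t -> adj F s r -> adj F t r -> [set s; t; r] \notin F -> h s != h t.
  move=> st sr tr nf; apply/eqP=> /glue_eq[e|[es et]|[es et]].
  - by rewrite e adj_irr in st.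
  - by case/negP: nf; rewrite es et; apply: (cycles_facialP _ _ _ lac); rewrite -?es -?et.
  by case/negP: nf; rewrite es et set3C; apply: (cycles_facialP _ _ _ lac); rewrite -?es -?et.
move=> xy xz yz nf L.
have hxy := D _ _ _ xy xz yz nf.
have hxz : h x != h z by apply: D xz xy _ _; rewrite 1?adj_sym // set3AC.
have hyz : h y != h z by apply: (D _ _ x); rewrite 1?(adj_sym _ _ x) // -set3_rot.
have A := adj_contract F3 a_neq_c (proj1 ra) (proj1 rc).
have := cycles_facialP _ _ _ L _ (A _ _ xz hxz) (A _ _ yz hyz).
rewrite mem_contract // => /and4P[_ _ _ f].
(* Here s is the vertex of the 3-cycle on ac. The new face comes either from the 3-cycle itself,
   which is not a face, or from the triangle with the other endpoint of ac in place of s; that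
   endpoint is o. *)
have G s t r : adj F s t -> adj F s r -> [set s; t; r] \notin F ->
    h s != h t -> h s != h r ->
    ([set h s; h t; h r] \in F) ||
    ([set unglue a c (h s); unglue a c (h t); unglue a c (h r)] \in F) ->
    (s == a) || (s == c) ->
  exists o p q r', [/\ o = a /\ p = c \/ o = c /\ p = a,
    [set o; p; q] \in F, [set o; p; r'] \in F, [set o; q; r'] \in F
    & [set s; t; r] = [set p; q; r']].
  move=> st sr nf' hst hsr f' sac.
  have hs : h s = a by case/orP: sac => /eqP->; rewrite /glue ?eqxx ?(negPf a_neq_c).
  have N u : h s != h u -> u != a /\ u != c.
    rewrite hs => hu; split; apply: contra hu => /eqP->; rewrite /glue ?eqxx //.
    by rewrite (negPf a_neq_c).
  have [[ta tc] [ra' rc']] := (N _ hst, N _ hsr).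
  move: f'; rewrite hs !glue_id // /unglue eqxx (negPf ta) (negPf ra') => f'.
  case/orP: sac => /eqP es; rewrite es in st sr nf' *.
    rewrite (negPf nf') /= in f'; have [ct cr _] := tri_adj F3 f'.
    exists c, a, t, r; split=> //; first by right.
      by rewrite (set3C c); apply: (cycles_facialP _ _ _ lac).
    by rewrite (set3C c); apply: (cycles_facialP _ _ _ lac).
  rewrite (negPf nf') orbF in f'; have [at_ ar _] := tri_adj F3 f'.
  exists a, c, t, r; split=> //; first by left.
    by apply: (cycles_facialP _ _ _ lac).
  by apply: (cycles_facialP _ _ _ lac).
case: (boolP ((x == a) || (x == c))) => [xi|]; first exact: G xi.
case: (boolP ((y == a) || (y == c))) => [yi|].
  have yx : adj F y x by rewrite adj_sym.
  have hyx : h y != h x by rewrite eq_sym.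
  rewrite set3C in nf; rewrite set3C (set3C (unglue a c (h x))) in f.
  have := G y x z yx yz nf hyx hyz f yi.
  move=> [o [p [q [r [H1 H2 H3 H4 H5]]]]].
  by exists o, p, q, r; split=> //; rewrite set3C.
case: (boolP ((z == a) || (z == c))) => [zi|].
  have zx : adj F z x by rewrite adj_sym.
  have zy : adj F z y by rewrite adj_sym.
  have hzx : h z != h x by rewrite eq_sym.
  have hzy : h z != h y by rewrite eq_sym.
  rewrite -set3_rot in nf; rewrite -set3_rot -(set3_rot (unglue a c (h z))) in f.
  have [o [p [q [r [H1 H2 H3 H4 H5]]]]] := G z x y zx zy nf hzx hzy f zi.
  by exists o, p, q, r; split=> //; rewrite -set3_rot.
rewrite !negb_or => /andP[za zc] /andP[ya yc] /andP[xa xc].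
case/negP: nf; move: f; rewrite !glue_id // /unglue.
by rewrite (negPf xa) (negPf ya) (negPf za) orbb.
Qed.

End Step.

End Collapse.

Section Step.
Variables (V : finType) (F : {set {set V}}) (a c : V).
Hypothesis F3 : only_triangles F.
Hypotheses (ac : adj F a c) (ra : regular_at F a) (rc : regular_at F c).
Let a_neq_c := adj_neq ac.
Local Notation F' := (contract F a c).
Local Notation h := (glue a c).

(** The ends are neither a nor c and stay fixed, so the image of the path under [glue] is again a
    path with distinct vertices, except that it shrinks when its middle edge is ac. *)
Lemma short_path_contract u v q :
  u != a -> u != c -> v != a -> v != c -> u != v -> short_path F u v q ->
  exists q', [/\ short_path F' u v q', {in q, forall x, h x \in q'} &
    forall x y, edge_on x y q -> h x != h y -> edge_on (h x) (h y) q'].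
Proof.
move=> ua uc va vc uv.
have hu : h u = u by rewrite glue_id.
have hv : h v = v by rewrite glue_id.
have N w m : w != a -> m != w -> h m != w.
  by move=> wa mw; rewrite /glue; case: ifP => // _; rewrite eq_sym.
have A x y := @adj_contract _ _ _ _ F3 a_neq_c x y (proj1 ra) (proj1 rc).
move=> /(short_pathP uv)[[adjuv ->]|[m [um mv ->]]|[m [n [[um mn nv] u_n mv ->]]]].
- exists [:: u; v]; split.
  + by rewrite short_path1 // -hu -hv A // hu hv.
  + by move=> x; rewrite !inE => /orP[]/eqP->; rewrite ?hu ?hv eqxx ?orbT.
  move=> x y; rewrite !edge_on_cons !edge_on1 !orbF.
  by case/orP=> /andP[/eqP-> /eqP->] _; rewrite hu hv !eqxx ?orbT.
- have hm_u : u != h m by rewrite eq_sym N // eq_sym (adj_neq um).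
  have hm_v : h m != v by rewrite N // (adj_neq mv).
  exists [:: u; h m; v]; split.
  + by rewrite short_path2 // -1?hu -1?hv A // ?hu ?hv.
  + by move=> x; rewrite !inE => /or3P[]/eqP->; rewrite ?hu ?hv eqxx ?orbT.
  move=> x y; rewrite !edge_on_cons !edge_on1 !orbF.
  by case/or4P=> /andP[/eqP-> /eqP->] _; rewrite ?hu ?hv !eqxx ?orbT.
have hm_u : u != h m by rewrite eq_sym N // eq_sym (adj_neq um).
have hn_u : u != h n by rewrite eq_sym N // eq_sym.
have hm_v : h m != v by rewrite N.
have hn_v : h n != v by rewrite N // (adj_neq nv).
have um' : adj F' u (h m) by rewrite -hu A // hu.
have nv' : adj F' (h n) v by rewrite -hv A // hv.
case: (h m =P h n) => [mn'|/eqP mn'].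
  exists [:: u; h m; v]; split.
  + by rewrite short_path2 // mn'.
  + by move=> x; rewrite !inE => /or4P[]/eqP->; rewrite ?hu ?hv -?mn' eqxx ?orbT.
  move=> x y; rewrite !edge_on_cons !edge_on1 !orbF.
  by case/or4P=> [||/andP[/eqP-> /eqP->]|/or3P[]] => [/andP[/eqP-> /eqP->]|/andP[/eqP-> /eqP->]||
    /andP[/eqP-> /eqP->]|/andP[/eqP-> /eqP->]|/andP[/eqP-> /eqP->]];
    rewrite ?hu ?hv -?mn' !eqxx ?orbT.
exists [:: u; h m; h n; v]; split.
- by rewrite short_path3 // A.
- by move=> x; rewrite !inE => /or4P[]/eqP->; rewrite ?hu ?hv eqxx ?orbT.
move=> x y; rewrite !edge_on_cons !edge_on1 !orbF.
by case/or4P=> [||/andP[/eqP-> /eqP->]|/or3P[]] => [/andP[/eqP-> /eqP->]|/andP[/eqP-> /eqP->]||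
    /andP[/eqP-> /eqP->]|/andP[/eqP-> /eqP->]|/andP[/eqP-> /eqP->]];
    rewrite ?hu ?hv !eqxx ?orbT.
Qed.

End Step.

(** * Descent of both statements through one contraction *)

Section Frame.
Variables (V : finType) (K : {set {set V}}) (e : 'I_3 * bool -> V).
Hypotheses (e_inj : injective e) (eK : forall k, e k \in vertices K).
Implicit Types (F : {set {set V}}) (a c x y : V).

Local Notation u i := (e (i, false)).
Local Notation v i := (e (i, true)).

(** Statement (1) in the form that descends, with good edges in place of contractible ones. The
    frame is abstract: its faces K and six labelled vertices e, with (i, false) for u'_i and (i,
    true) for v'_i. *)
Definition edges_settled F := forall x y, adj F x y -> ~~ adj K x y ->
  cycles_facial F x y -> exists i, edge_on_short_path F (u i) (v i) x y.

Definition vertices_settled F := forall x, x \in vertices F -> x \notin vertices K ->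
  (forall y, adj F x y -> cycles_facial F x y) ->
  exists i j : 'I_3, i < j /\
    vertex_on_short_path F (u i) (v i) x /\ vertex_on_short_path F (u j) (v j) x.

Lemma ends_neq i : u i != v i.
Proof. by apply/eqP=> /e_inj[]. Qed.

Lemma end_neq k x : x \notin vertices K -> e k != x.
Proof. by apply: contraNneq => <-. Qed.

Section Contraction.
Variables (F : {set {set V}}) (a c : V).
Hypothesis F3 : only_triangles F.
Hypotheses (ac : adj F a c) (ra : regular_at F a) (rc : regular_at F c).
Hypothesis lac : cycles_facial F a c.
Hypotheses (aK : a \notin vertices K) (cK : c \notin vertices K).
Let a_neq_c := adj_neq ac.
Local Notation F' := (contract F a c).
Local Notation h := (glue a c).

Lemma edge_path_contract i x y : h x != h y ->
  edge_on_short_path F (u i) (v i) x y ->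
  edge_on_short_path F' (u i) (v i) (h x) (h y).
Proof.
move=> hxy [q [sq xyq]].
have [||||q' [sq' _ H]] :=
  short_path_contract F3 ac ra rc _ _ _ _ (ends_neq i) sq; rewrite ?end_neq //.
by exists q'; split; last exact: H.
Qed.

Lemma vertex_path_contract i x :
  vertex_on_short_path F (u i) (v i) x ->
  vertex_on_short_path F' (u i) (v i) (h x).
Proof.
move=> [q [sq xq]].
have [||||q' [sq' H _]] :=
  short_path_contract F3 ac ra rc _ _ _ _ (ends_neq i) sq; rewrite ?end_neq //.
by exists q'; split; last exact: H.
Qed.

Lemma glue_frame x : x \in vertices K -> h x = x.
Proof. by move=> xK; rewrite glue_id //; apply: contraNneq cK => <-. Qed.

Lemma edges_settled_contract : edges_settled F -> edges_settled F'.
Proof.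
move=> S x' y' xy' nK L; have xy := adj_neq xy'.
have [x [y [adjxy ex ey]]] := adj_contract_lift xy'.
move: xy nK L; rewrite -ex -ey => xy nK L.
have nK0 : ~~ adj K x y.
  apply: contra nK => /[dup] xyK /adj_vertex xK; rewrite glue_frame // glue_frame //.
  by rewrite adj_sym in xyK; apply: adj_vertex xyK.
suff [i Hi] : exists i, edge_on_short_path F (u i) (v i) x y.
  by exists i; apply: edge_path_contract.
case: (boolP (cycles_facial F x y)) => [|/cycles_facialPn[z [xz yz nf]]]; first exact: S.
have [o [p [q [r [opac opq opr oqr D]]]]] :=
  nonfacial_collapse F3 ac ra rc lac adjxy xz yz nf L.
have [op oq pq] := tri_adj F3 opq; have [_ or pr] := tri_adj F3 opr.
have [_ _ qr] := tri_adj F3 oqr.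
have [oK pK ro] : [/\ o \notin vertices K, p \notin vertices K & regular_at F o].
  by case: opac => -[-> ->].
(* The edge op is the contracted edge ac, interior and good. *)
have [||i Hi] := S o p op.
- by apply: contra oK; apply: adj_vertex.
- exact: (degree3_cycles_facial F3 ro opq opr oqr op).
exists i.
have xD : x \in [set p; q; r] by rewrite -D !inE eqxx.
have yD : y \in [set p; q; r] by rewrite -D !inE eqxx orbT.
have xy0 := adj_neq adjxy.
have oD t : adj F o t -> t \in [set p; q; r] := degree3 F3 ro opq opr oqr (y := t).
(* A path s, o, p, t starts at a neighbour of o other than p, that is at q or r. It can hence be
   rerouted inside the triangle pqr. *)
have G s t : adj F s o -> adj F p t -> s != t -> s != p ->
    edge_on_short_path F s t x y.
  rewrite adj_sym => /oD; rewrite !inE -orbA => /or3P[/eqP->|/eqP->|/eqP->] pt st.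
  - by rewrite eqxx.
  - by move=> _; apply: edge_on_short_path_triangle pq pr qr pt st xD yD xy0.
  move=> _; rewrite set3AC in xD yD.
  by apply: edge_on_short_path_triangle pr pq _ pt st xD yD xy0; rewrite adj_sym.
case: Hi => s [ss os]; have uv := ends_neq i.
have [uo up] := (end_neq (i, false) oK, end_neq (i, false) pK).
have [vo vp] := (end_neq (i, true) oK, end_neq (i, true) pK).
(* Neither o nor p is an end of the path, so op is the middle edge of a path of length 3, in one of
   two directions. *)
case: (short_pathP uv ss) os => [[_ ->]|[m [_ _ ->]]|[m [n [[um mn nv] _ _ ->]]]];
  rewrite !edge_on_cons !edge_on1 ![o == u i]eq_sym ![o == v i]eq_sym
    ![p == u i]eq_sym ![p == v i]eq_sym (negPf uo) (negPf up) (negPf vo) (negPf vp)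
    ?andbF ?orbF //=.
case/orP=> /andP[/eqP em /eqP en]; rewrite -em -en in um mn nv.
  exact: G.
apply: edge_on_short_path_rev; first by rewrite eq_sym.
by apply: G; rewrite 1?adj_sym // eq_sym.
Qed.

Lemma vertices_settled_contract : vertices_settled F -> vertices_settled F'.
Proof.
move=> S x xF' xK Lx.
have [x0 [f [fF x0f ex]]] : exists x0 f, [/\ f \in F, x0 \in f & x = h x0].
  case/bigcupP: xF' => g /imsetP[f]; rewrite inE => /andP[fF _] -> /imsetP[x0 x0f xe].
  by exists x0, f.
have xc : x != c by rewrite ex glue_neq.
have hx : h x = x by rewrite glue_id.
have xF : x \in vertices F.
  rewrite ex /glue; case: ifP => _; first exact: adj_vertex ac.
  by apply/bigcupP; exists f.
have T y i j : vertex_on_short_path F (u i) (v i) y /\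
    vertex_on_short_path F (u j) (v j) y -> h y = x ->
    vertex_on_short_path F' (u i) (v i) x /\ vertex_on_short_path F' (u j) (v j) x.
  by move=> [P Q] <-; split; apply: vertex_path_contract.
case: (boolP [forall y, adj F x y ==> cycles_facial F x y]) => [/forallP L|].
  have [|i [j [ij P]]] := S x xF xK; first by move=> y; apply/implyP.
  by exists i, j; split=> //; apply: T P hx.
rewrite negb_forall => /existsP[y]; rewrite negb_imply => /andP[xy nL].
have hxy : h x != h y.
  apply/eqP=> /glue_eq[e1|[e1 e2]|[e1 _]]; last by rewrite e1 eqxx in xc.
    by rewrite e1 adj_irr in xy.
  by rewrite e1 e2 lac in nL.
have [z [xz yz nf]] := cycles_facialPn nL.
have L' : cycles_facial F' (h x) (h y).
  by rewrite hx; apply: Lx; have := adj_contract F3 a_neq_c ra.1 rc.1 xy hxy; rewrite hx.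
have [o [p [q [r [opac opq opr oqr D]]]]] :=
  nonfacial_collapse F3 ac ra rc lac xy xz yz nf L'.
have [op oq pq] := tri_adj F3 opq; have [_ or pr] := tri_adj F3 opr.
have [_ _ qr] := tri_adj F3 oqr.
have [oK pK ro ho] :
    [/\ o \notin vertices K, p \notin vertices K, regular_at F o & h o = a].
  case: opac => -[-> ->]; rewrite /glue ?eqxx ?(negPf a_neq_c); by split.
have [i [j [ij P]]] : exists i j : 'I_3, i < j /\
    vertex_on_short_path F (u i) (v i) o /\ vertex_on_short_path F (u j) (v j) o.
  apply: S oK _; first exact: adj_vertex op.
  by move=> t ot; apply: (degree3_cycles_facial F3 ro opq opr oqr ot).
case: (x =P a) => [xa|/eqP xa]; first by exists i, j; split=> //; apply: T P _; rewrite ho.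
(* Each short path through o has an end next to o. The neighbours of o are p, x and one more vertex
   r', and only r' can be on the frame; but two different indices cannot share it. *)
have [r' R] : exists r', forall k, vertex_on_short_path F (u k) (v k) o ->
    exists b, e (k, b) = r'.
  have xp : x != p by case: opac => -[_ ->].
  have: x \in [set p; q; r] by rewrite -D !inE eqxx.
  have Q k : vertex_on_short_path F (u k) (v k) o ->
      exists b, (e (k, b) == q) || (e (k, b) == r).
    move=> P'; have [uo vo] := (end_neq (k, false) oK, end_neq (k, true) oK).
    have [up vp] := (end_neq (k, false) pK, end_neq (k, true) pK).
    have := vertex_on_short_path_adj (ends_neq k) P'.
    rewrite eq_sym uo eq_sym vo => /(_ isT isT)[]/(degree3 F3 ro opq opr oqr).
      by rewrite !inE (negPf up); exists false.
    by rewrite !inE (negPf vp); exists true.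
  rewrite !inE (negPf xp) /= => /orP[]/eqP exq; [exists r | exists q];
    move=> k /Q[b]; rewrite -exq (negPf (end_neq _ xK)) ?orbF => /eqP; by exists b.
have [b1 e1] := R i (proj1 P); have [b2 e2] := R j (proj2 P).
by case: (e_inj (etrans e1 (esym e2))) ij => -> _; rewrite ltnn.
Qed.

End Contraction.
End Frame.

(** * Cycles minus a vertex *)

Section Graphs.
Variable T : finType.
Implicit Types (S : {set T}) (r : rel T).

Lemma handshake S r : symmetric r -> irreflexive r ->
  ~~ odd (\sum_(x in S) #|[set y in S | r x y]|).
Proof.
move=> rC rI.
under eq_bigr do rewrite -sum1dep_card big_mkcondr /=.
(* A counts each edge once, from its end of lower rank. *)
pose A := \sum_(x in S) \sum_(y in S) (r x y && (enum_rank x < enum_rank y)).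
suff -> : \sum_(x in S) \sum_(y in S) (if r x y then 1 else 0) = A + A.
  by rewrite addnn odd_double.
have {2}-> : A = \sum_(x in S) \sum_(y in S) (r x y && (enum_rank y < enum_rank x)).
  by rewrite /A exchange_big; apply: eq_bigr => x _; apply: eq_bigr => y _; rewrite rC.
rewrite -big_split; apply: eq_bigr => x _ /=.
rewrite -big_split; apply: eq_bigr => y _ /=.
case rxy: (r x y) => //=; case: ltngtP => //= /ord_inj/enum_rank_inj e.
by rewrite e rI in rxy.
Qed.

(* If b and d were separated by the removal of c from the cycle, b would be the
   only vertex of odd degree of its component. *)
Lemma cycle_minus_vertex r b c d :
  symmetric r -> irreflexive r -> b != d ->
  (forall y, r c y = (y == b) || (y == d)) ->
  (forall x, connect r c x -> #|[set y | r x y]| = 2) ->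
  forall x, connect r c x -> x != c ->
    connect (fun x y => [&& r x y, x != c & y != c]) b x.
Proof.
move=> rC rI bd rc deg.
set r' := (fun x y => _).
have rcb : r c b by rewrite rc eqxx.
have bc : b != c by apply: contraTneq rcb => ->; rewrite rI.
have cb : connect r c b by apply: connect1.
have sub x : connect r' b x -> connect r c x.
  by move=> bx; apply: connect_trans cb (connect_sub _ bx) => y z /and3P[yz _ _]; apply: connect1.
have xc x : connect r' b x -> x != c.
  case/connectP=> p; case/lastP: p => [_ -> //|p y].
  by rewrite rcons_path last_rcons => /andP[_ /and3P[_ _ ?]] ->.
have dS : connect r' b d.
  apply: contraT => nd; pose S := [set x | connect r' b x].
  have := @handshake S r rC rI; rewrite (bigD1 b) /= ?inE //.
  have -> : [set y in S | r b y] = [set y | r b y] :\ c.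
    apply/setP=> y; rewrite !inE; case rby: (r b y); rewrite ?andbF // !andbT.
    apply/idP/idP=> [/xc //|yc]; apply: connect1; rewrite /r' rby bc yc //.
  have -> : \sum_(x in S | x != b) #|[set y in S | r x y]| = \sum_(x in S | x != b) 2.
    apply: eq_bigr => x /andP[]; rewrite inE => bx xb.
    rewrite -(deg x (sub _ bx)); congr #|pred_of_set _|; apply/setP=> y; rewrite !inE.
    case rxy: (r x y); rewrite ?andbF // andbT; apply: (connect_trans bx (connect1 _)).
    rewrite /r' rxy (xc x bx) /=; apply: contraNneq nd => yc.
    by move: rxy; rewrite yc rC rc (negPf xb) => /eqP <-.
  have := deg _ cb; rewrite (cardsD1 c) inE rC rc eqxx => -[]; rewrite add0n => ->.
  by rewrite sum_nat_const oddD oddM andbF.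
move=> x /connectP[p] + ->.
(* A walk from c may return to c, but each time it leaves c it enters b or d, both reachable from b
   without c. *)
suff H y : path r y p -> (y == c) || connect r' b y ->
    (last y p == c) || connect r' b (last y p).
  by move=> /H; rewrite eqxx => /(_ isT)/orP[->|].
elim: p y => [|z p IH] y //= /andP[yz /IH{}IH] h; apply: IH.
case: (z =P c) => //= /eqP zc; case/orP: h => [/eqP e|by_].
  by move: yz; rewrite e rc => /orP[]/eqP->.
by apply: (connect_trans by_ (connect1 _)); rewrite /r' yz zc xc.
Qed.

End Graphs.

(** * Edges whose 3-cycles are all facial are contractible *)

Lemma connect_map (T U : finType) (r : rel T) (r' : rel U) (g : T -> U) :
  (forall x y, r x y -> connect r' (g x) (g y)) ->
  forall x y, connect r x y -> connect r' (g x) (g y).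
Proof.
move=> H x _ /connectP[p xp ->]; elim: p x xp => [|z p IH] x //=.
by case/andP=> xz /IH; apply: connect_trans; apply: H.
Qed.

Section ContractTriangulation.
Variables (V : finType) (F : {set {set V}}) (a c : V).
Hypotheses (tF : triangulation F) (adjac : adj F a c) (lac : cycles_facial F a c).
(** Faces apq and cpq would fall together in the contraction. For a good edge ac this happens only
    in the tetrahedron. *)
Hypothesis no_opposite : forall p q, [set a; p; q] \in F -> [set c; p; q] \in F -> False.
Implicit Types (x y z p q s t : V).
Local Notation F' := (contract F a c).
Local Notation h := (glue a c).

Let F3 : only_triangles F. Proof. by case: tF. Qed.
Let ac : a != c := adj_neq adjac.
Let deg2 x y : adj F x y -> #|thirds F x y| = 2.
Proof. by case: (triangulation_regular x tF) => + _; apply. Qed.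

Let adj' x y : adj F x y -> h x != h y -> adj F' (h x) (h y).
Proof. by apply: adj_contract => // z; apply: deg2. Qed.

Let h_id x : x != a -> forall x0, h x0 = x -> x0 = x.
Proof. by move=> xa x0; rewrite /glue; case: eqP => // _ e; rewrite e eqxx in xa. Qed.

Let h_neq x y : x != a -> x != c -> x != y -> h x != h y.
Proof.
move=> xa xc xy; apply/eqP=> /glue_eq[e|[e _]|[e _]].
- by rewrite e eqxx in xy.
- by rewrite e eqxx in xa.
by rewrite e eqxx in xc.
Qed.

Lemma contract_only_triangles : only_triangles F'.
Proof.
move=> g /imsetP[f fF0 ->]; move: fF0; rewrite inE => /andP[fF nac].
rewrite card_in_imset ?F3 // => x y xf yf /glue_eq[//|[ex ey]|[ex ey]];
by case/negP: nac; rewrite -ex -ey; apply/subsetP=> t /set2P[]->.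
Qed.
Let F3' := contract_only_triangles.

(** An edge off a keeps its faces up to renaming. For an edge from a to t: if act is a face, at and
    ct have four third vertices in all, of which c and a disappear; otherwise only one of at and ct
    is an edge, since ac is good. *)
Lemma contract_deg2 x y : adj F' x y -> #|thirds F' x y| = 2.
Proof.
suff H s t : t != a -> adj F' s t -> #|thirds F' s t| = 2.
  move=> xy; case: (y =P a) => [ya|/eqP ya]; last exact: H.
  rewrite thirdsC; apply: H; rewrite 1?adj_sym // -ya; exact: adj_neq xy.
move=> ta st; have [p] := adjP3 F3' _ _ st.
rewrite mem_contract // => /and4P[sc tc _ _].
have [s0 [t0 [st0 es et]]] := adj_contract_lift st.
move/(h_id ta): et st0 => -> st0.
case: (s =P a) => [sa|/eqP sa]; last first.
  rewrite thirds_contract_unmerged // card_in_imset.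
    by rewrite deg2 // -(h_id sa es).
  move=> q r; rewrite !inE => f g /glue_eq[//|[eq er]|[eq er]].
    by case: (@no_opposite s t); rewrite set3_rot -?eq -?er.
  by case: (@no_opposite s t); rewrite set3_rot -?eq -?er.
rewrite {}sa in st sc es *; rewrite thirds_contract_merged //.
have AC : thirds F a t :&: thirds F c t = set0.
  by apply/setP=> q; rewrite !inE; apply/negP=> /andP[f]; apply: no_opposite.
case: (boolP ([set a; c; t] \in F)) => [act|nact].
  have [_ at_ ct] := tri_adj F3 act.
  set U := thirds F a t :|: thirds F c t.
  have aU : a \in U by rewrite !inE (set3AC c t) (set3C c a) act orbT.
  have cU : c \in U :\ a by rewrite in_setD1 eq_sym ac !inE (set3AC a t) act.
  have := cardsUI (thirds F a t) (thirds F c t).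
  by rewrite -/U AC cards0 !deg2 // (cardsD1 a U) (cardsD1 c (U :\ a)) aU cU addn0 !add1n => -[].
have aA : a \notin thirds F a t by rewrite inE; apply/negP=> /(tri_neq F3)[]; rewrite eqxx.
have cC : c \notin thirds F c t by rewrite inE; apply/negP=> /(tri_neq F3)[]; rewrite eqxx.
have cA : c \notin thirds F a t by rewrite inE set3AC.
have aC : a \notin thirds F c t by rewrite inE set3AC set3C.
have -> : (thirds F a t :|: thirds F c t) :\ a :\ c = thirds F a t :|: thirds F c t.
  apply/setP=> q; rewrite in_setD1 in_setD1 in_setU.
  case: (q =P c) => [->|_]; first by rewrite (negPf cA) (negPf cC).
  by case: (q =P a) => [->|//]; rewrite (negPf aA) (negPf aC).
have nadj : adj F a t -> adj F c t -> False.
  by move=> at_ ct; case/negP: nact; apply: (cycles_facialP _ _ _ lac).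
have : s0 = a \/ s0 = c by move: es; rewrite /glue; case: eqP; [right | left].
case=> e; rewrite {}e in st0.
  have -> : thirds F c t = set0.
    apply/setP=> q; rewrite !inE; apply/negP=> /(tri_adj F3)[ct _ _]; exact: nadj ct.
  by rewrite setU0 deg2.
have -> : thirds F a t = set0.
  apply/setP=> q; rewrite !inE; apply/negP=> /(tri_adj F3)[at_ _ _]; exact: nadj st0.
by rewrite set0U deg2.
Qed.

Lemma common_thirds : exists b d, b != d /\ thirds F a c = [set b; d].
Proof. by apply/cards2P; rewrite deg2. Qed.

Lemma link_minus v w b d x : adj F v w -> thirds F v w = [set b; d] -> b != d ->
  x != w -> adj F v x ->
  connect (fun s t => [&& link F v s t, s != w & t != w]) b x.
Proof.
move=> vw vwd bd xw vx; have [_ L] := triangulation_regular v tF.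
apply: (@cycle_minus_vertex _ (link F v) b w d) => //.
- exact: link_sym.
- move=> y; rewrite /link; apply/negP=> /(tri_neq F3)[_ _]; by rewrite eqxx.
- by move=> y; have /setP/(_ y) := vwd; rewrite !inE.
- move=> y wy; have vy : adj F v y.
    case/connectP: wy => p; case/lastP: p => [_ -> //|p z].
    rewrite rcons_path last_rcons => /andP[_ f] ->.
    by have [_ ->] := tri_adj F3 f.
  by rewrite -(deg2 vy).
exact: L.
Qed.

(** The new link of a is made of the link of a without c and the link of c without a, two arcs that
    both start at b. Any other link is the image of the old one. *)
Lemma contract_link v x y : adj F' v x -> adj F' v y -> connect (link F' v) x y.
Proof.
move=> vx vy; have [x0 [v0 [vx0 ex ev]]] : exists x0 v0, [/\ adj F v0 x0, h x0 = x & h v0 = v].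
  by have [v0 [x0 []]] := adj_contract_lift vx; exists x0, v0.
have [y0 [v1 [vy0 ey ev1]]] : exists y0 v0, [/\ adj F v0 y0, h y0 = y & h v0 = v].
  by have [v1 [y0 []]] := adj_contract_lift vy; exists y0, v1.
have vc : v != c by rewrite -ev glue_neq.
case: (v =P a) => [va|/eqP va]; last first.
  move: vx0 vy0; rewrite (h_id va ev) (h_id va ev1) => vx0 vy0.
  rewrite -ex -ey; apply: connect_map (proj2 (triangulation_regular v tF) _ _ vx0 vy0).
  move=> s t f; case: (h s =P h t) => [->|/eqP st]; first exact: connect0.
  have [vs vt _] := tri_neq F3 f.
  apply: connect1; rewrite /link -(glue_id a vc); apply: contract_face => //;
    exact: h_neq.
rewrite {}va in ev ev1 vx vy *; have [b [d [bd abd]]] := common_thirds.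
have sC : connect_sym (link F' a) by apply/sym_connect_sym/link_sym.
suff H z z0 w : adj F w z0 -> h z0 = z -> h w = a -> z != a -> connect (link F' a) b z.
  apply: (@connect_trans _ _ b).
    by rewrite sC; apply: H vx0 ex ev _; rewrite eq_sym (adj_neq vx).
  by apply: H vy0 ey ev1 _; rewrite eq_sym (adj_neq vy).
move=> wz0 ez ew za; move: (h_id za ez) wz0 => -> wz.
have zc : z != c by rewrite -ez glue_neq.
have : w = a \/ w = c by move: ew; rewrite /glue; case: eqP; [right | left].
case=> e; rewrite {}e in wz.
  apply: (connect_sub _ (link_minus adjac abd bd zc wz)) => s t /and3P[f sc tc].
  by apply: connect1; move: f; rewrite /link mem_contract // ac sc tc => ->.
have adjca : adj F c a by rewrite adj_sym.
rewrite thirdsC in abd.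
apply: (connect_sub _ (link_minus adjca abd bd za wz)) => s t /and3P[f sa ta].
have [cs ct _] := tri_neq F3 f; rewrite eq_sym in cs; rewrite eq_sym in ct.
apply: connect1; move: f; rewrite /link mem_contract // ac cs ct /unglue eqxx.
by rewrite (negPf sa) (negPf ta) => ->; rewrite orbT.
Qed.

Lemma exists_apex : exists b, [/\ [set a; c; b] \in F, adj F' a b & b != c].
Proof.
have [b bac] := adjP3 F3 _ _ adjac; have [_ ab cb] := tri_adj F3 bac.
have bc : b != c by rewrite eq_sym (adj_neq cb).
have ba : b != a by rewrite eq_sym (adj_neq ab).
exists b; split=> //; have hab : h a != h b by rewrite eq_sym h_neq // eq_sym.
by have := adj' ab hab; rewrite !glue_id.
Qed.

Lemma contract_vertices : vertices F' = vertices F :\ c.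
Proof.
apply/setP=> x; rewrite in_setD1; apply/idP/andP=> [/bigcupP[g /imsetP[f]]|[xc]].
  rewrite inE => /andP[fF _] -> /imsetP[y yf ->]; split; first exact: glue_neq.
  rewrite /glue; case: ifP => _; first exact: adj_vertex adjac.
  by apply/bigcupP; exists f.
have [b [_ ab _]] := exists_apex.
case: (x =P a) => [-> _|/eqP xa /bigcupP[f fF xf]]; first exact: adj_vertex ab.
have [y] : exists y, y \in f :\ x.
  by apply/set0Pn; rewrite -card_gt0; move: (F3 fF); rewrite (cardsD1 x) xf => -[]; rewrite add0n => ->.
 rewrite in_setD1 => /andP[yx yf].
have xy : adj F x y by apply: (adj_face fF) => //; rewrite eq_sym.
rewrite -(glue_id a xc); apply: (adj_vertex (y := h y)); apply: adj' => //.
by rewrite h_neq // eq_sym.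
Qed.

Lemma contract_triangulation : triangulation F'.
Proof.
have [b [_ ab _]] := exists_apex.
apply: triangulation_intro.
- by case/andP: ab => _ /existsP[f /andP[fF' _]]; apply/set0Pn; exists f.
- exact: F3'.
- by move=> x; split; [apply: contract_deg2 | apply: contract_link].
move=> x y; rewrite contract_vertices !in_setD1 => /andP[xc xF] /andP[yc yF].
rewrite -(glue_id a xc) -(glue_id a yc).
apply: (@connect_map _ _ (adj F)); last by case: tF => _ _ _ _; apply.
move=> s t st; case: (h s =P h t) => [->|/eqP hst]; first exact: connect0.
exact/connect1/adj'.
Qed.

(** The two faces on ac disappear. Two other faces could coincide only as apq and cpq. *)
Lemma contract_card : #|F| = #|F'| + 2.
Proof.
have <- : #|[set f in F | [set a; c] \subset f]| = 2.
  by rewrite card_faces_thirds // deg2.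
rewrite addnC -(cardsID [set f : {set V} | [set a; c] \subset f] F); congr (_ + _).
  by congr #|pred_of_set _|; apply/setP=> f; rewrite !inE.
rewrite card_in_imset; last first.
  move=> f g; rewrite !inE => /andP[fF fac] /andP[gF gac] e.
  have {}e : h @: f = h @: g by exact: e.
  wlog cg : f g fF fac gF gac e / c \in f -> c \in g.
    move=> H; case cg: (c \in g); first by apply: H => //; rewrite cg.
    by apply/esym; apply: H => //; rewrite cg.
  have id_h (k : {set V}) : c \notin k -> h @: k = k.
    move=> ck; rewrite -[RHS]imset_id; apply: eq_in_imset => t tk.
    by rewrite glue_id //; apply: contraNneq ck => <-.
  have ug (k : {set V}) : c \in k -> ~~ ([set a; c] \subset k) -> unglue a c @: (h @: k) = k.
    move=> ck ack; rewrite -imset_comp -[RHS]imset_id; apply: eq_in_imset => t tk /=.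
    rewrite /unglue /glue; case: (t =P c) => [->|_]; first by rewrite eqxx.
    case: eqP => // ta; case/negP: ack; rewrite ta in tk.
    by apply/subsetP=> s /set2P[]->.
  case cf: (c \in f); first by rewrite -(ug f) // e ug ?cg.
  case cg': (c \in g); last by rewrite -(id_h f) ?cf // e id_h ?cg'.
  have [p] : exists p, p \in g :\ c.
    by apply/set0Pn; rewrite -card_gt0; move: (F3 gF); rewrite (cardsD1 c) cg' => -[]; rewrite add0n => ->.
  rewrite in_setD1 => /andP[pc pg].
  have [|q eg] := face_third F3 gF cg' pg; first by rewrite eq_sym.
  rewrite eg in gF; have [_ cq _] := tri_neq F3 gF.
  case: (no_opposite (p := p) (q := q)) => //.
  move: fF; rewrite -(id_h f) ?cf // e eg imset3 (glue_id a pc).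
  rewrite eq_sym in cq; rewrite (glue_id a cq).
  by rewrite /glue eqxx.
by congr #|pred_of_set _|; apply/setP=> f; rewrite !inE andbC.
Qed.

(** One vertex and two faces are lost, hence three edges by double counting, and -1 + 3 - 2 = 0. *)
Lemma contract_euler_char : euler_char F' = euler_char F.
Proof.
have d := double_counting F3 deg2; have d' := double_counting F3' contract_deg2.
have vF : c \in vertices F by rewrite (adj_vertex (y := a)) // adj_sym.
have ev := cardsD1 c (vertices F); rewrite vF -contract_vertices /= in ev.
have ef := contract_card.
rewrite /euler_char ev ef.
have -> : #|edges F| = #|edges F'| + 3.
  apply/eqP; rewrite -(eqn_pmul2r (isT : 0 < 2)) mulnDl -d -d' ef mulnDl //.
rewrite !PoszD /=; ring.
Qed.

End ContractTriangulation.

(** * The tetrahedron, the exception among good edges *)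

Section Tetrahedron.

(* The parity of the permutation that starts with i, j, k. *)
Definition tetra_sign (i j k : nat) : bool :=
  let l := (6 - i - j - k)%N in
  (j < i) (+) (k < i) (+) (l < i) (+) (k < j) (+) (l < j) (+) (l < k).

(** In a permutation of four elements, rotating the first three entries is even, while swapping the
    first two, or the third and the fourth, is odd. *)
Lemma tetrahedron_orientable (V : finType) (F : {set {set V}}) (g : V -> nat) :
  {in vertices F &, injective g} -> {in vertices F, forall x, g x < 4} ->
  only_triangles F -> orientable F.
Proof.
move=> gI g4 F3.
have vF x y z t : [set x; y; z] \in F -> t \in [set x; y; z] -> t \in vertices F.
  by move=> f tf; apply/bigcupP; exists [set x; y; z].
exists (fun x y z => tetra_sign (g x) (g y) (g z)); split.
  move=> x y z f; have [xy xz yz] := tri_neq F3 f.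
  have [xF yF zF] : [/\ x \in vertices F, y \in vertices F & z \in vertices F].
    by split; apply: vF f _; rewrite !inE eqxx ?orbT.
  have {xy}: g x != g y by apply: contra xy => /eqP/(gI _ _ xF yF)->.
  have {xz}: g x != g z by apply: contra xz => /eqP/(gI _ _ xF zF)->.
  have {yz}: g y != g z by apply: contra yz => /eqP/(gI _ _ yF zF)->.
  move: (g4 x xF) (g4 y yF) (g4 z zF); move: (g x) (g y) (g z).
  by case=> [|[|[|[|//]]]]; case=> [|[|[|[|//]]]]; case=> [|[|[|[|//]]]].
move=> x y z t f f'; have [xy xz yz] := tri_neq F3 f.
have [_ xt yt] := tri_neq F3 f'.
have [xF yF zF] : [/\ x \in vertices F, y \in vertices F & z \in vertices F].
  by split; apply: vF f _; rewrite !inE eqxx ?orbT.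
have tF : t \in vertices F by apply: vF f' _; rewrite !inE eqxx ?orbT.
move=> o1 o2; apply: (gI) => //.
have {xy}: g x != g y by apply: contra xy => /eqP/(gI _ _ xF yF)->.
have {xz}: g x != g z by apply: contra xz => /eqP/(gI _ _ xF zF)->.
have {yz}: g y != g z by apply: contra yz => /eqP/(gI _ _ yF zF)->.
have {xt}: g x != g t by apply: contra xt => /eqP/(gI _ _ xF tF)->.
have {yt}: g y != g t by apply: contra yt => /eqP/(gI _ _ yF tF)->.
move: (g4 x xF) (g4 y yF) (g4 z zF) (g4 t tF) o1 o2; move: (g x) (g y) (g z) (g t).
by case=> [|[|[|[|//]]]]; case=> [|[|[|[|//]]]]; case=> [|[|[|[|//]]]]; case=> [|[|[|[|//]]]].
Qed.

Lemma tetrahedron_euler_char (V : finType) (X : {set V}) :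
  #|X| = 4 -> euler_char [set f : {set V} | f \subset X & #|f| == 3] = 2%R.
Proof.
move=> X4; set F := (X in euler_char X).
have F3 : only_triangles F by move=> f; rewrite inE => /andP[_ /eqP].
have cover2 (e : {set V}) : e \subset X -> #|e| <= 3 -> exists2 f, f \in F & e \subset f.
  move=> eX e3; have : 3 - #|e| <= #|X :\: e|.
    by rewrite cardsD (setIidPr eX) X4 leq_sub2r.
  case/card_geqP=> s [us ss sX]; exists (e :|: [set x in s]); last exact: subsetUl.
  have disj : [disjoint e & [set x in s]].
    rewrite -setI_eq0; apply/eqP/setP=> x; rewrite !inE; apply/negP=> /andP[xe /sX].
    by rewrite inE xe.
  rewrite inE subUset eX /= cardsU (disjoint_setI0 disj) cards0 subn0.
  rewrite cardsE (card_uniqP us) ss subnKC // eqxx andbT.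
  by apply/subsetP=> x; rewrite inE => /sX; rewrite inE => /andP[].
rewrite /euler_char.
have -> : vertices F = X.
  apply/setP=> x; apply/bigcupP/idP=> [[f]|xX].
    by rewrite inE => /andP[/subsetP fX _]; apply: fX.
  have [||f fF xf] := cover2 [set x]; rewrite ?sub1set ?cards1 //.
  by exists f => //; rewrite -sub1set.
have -> : edges F = [set e : {set V} | e \subset X & #|e| == 2].
  rewrite edgesE //; apply/setP=> e; rewrite !inE andbC.
  case e2: (#|e| == 2); rewrite ?andbF // !andbT; apply/existsP/idP.
    by case=> f /andP[]; rewrite inE => /andP[fX _] ef; apply: subset_trans fX.
  move=> eX; have [|f fF ef] := cover2 e eX; first by rewrite (eqP e2).
  by exists f; rewrite fF.
by rewrite !cards_draws X4.
Qed.

Lemma tetrahedron_spherical (V : finType) (X : {set V}) :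
  #|X| = 4 -> spherical [set f : {set V} | f \subset X & #|f| == 3].
Proof.
move=> X4; set F := (X in spherical X).
have K4E : K4 = [set f : {set 'I_4} | f \subset [set: 'I_4] & #|f| == 3].
  by apply/setP=> f; rewrite !inE subsetT.
split; first by rewrite tetrahedron_euler_char // K4E tetrahedron_euler_char // cardsT card_ord.
have FX x : x \in vertices F -> x \in X.
  by case/bigcupP=> f; rewrite inE => /andP[/subsetP fX _]; apply: fX.
split=> _; last first.
  apply: (@tetrahedron_orientable _ _ (index^~ (enum X))).
  - by move=> x y /FX xX /FX yX; apply: (index_inj x); rewrite mem_enum.
  - by move=> x /FX xX; rewrite -X4 cardE index_mem mem_enum.
  by move=> f; rewrite inE => /andP[_ /eqP].
apply: (@tetrahedron_orientable _ _ (@nat_of_ord 4)).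
- by move=> i j _ _; apply: ord_inj.
- by move=> i _; apply: ltn_ord.
by move=> f; rewrite inE => /eqP.
Qed.

(** The triples in X already give two faces on each edge inside X. So the links of vertices of X
    stay in X and, by connectedness, nothing lies outside X. *)
Lemma triangulation_tetrahedron (V : finType) (F : {set {set V}}) (X : {set V}) :
  triangulation F -> #|X| = 4 ->
  (forall f : {set V}, f \subset X -> #|f| = 3 -> f \in F) -> spherical F.
Proof.
move=> tF X4 XF; have F3 : only_triangles F by case: tF.
have XFt x y z : x \in X -> y \in X -> z \in X -> x != y -> x != z -> y != z ->
    [set x; y; z] \in F.
  move=> xX yX zX xy xz yz; apply: XF; last exact/card_set3.
  by apply/subsetP=> t; rewrite !inE -orbA => /or3P[]/eqP->.
have card_minus2 x y : x \in X -> y \in X -> x != y -> #|X :\ x :\ y| = 2.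
  move=> xX yX xy; move: X4; rewrite (cardsD1 x) xX (cardsD1 y) in_setD1 yX eq_sym xy.
  by case.
have thX x y : x \in X -> y \in X -> adj F x y -> thirds F x y = X :\ x :\ y.
  move=> xX yX xy; have xy' := adj_neq xy; apply/esym/eqP; rewrite eqEcard.
  rewrite (proj1 (triangulation_regular x tF)) // card_minus2 // andbT.
  apply/subsetP=> z; rewrite !inE => /and3P[zy zx zX].
  by apply: XFt; rewrite // eq_sym.
have adjX x y : x \in X -> adj F x y -> y \in X.
  move=> xX xy; have [x0] : exists x0, x0 \in X :\ x.
    by apply/set0Pn; rewrite -card_gt0; move: X4; rewrite (cardsD1 x) xX => -[]; rewrite add0n => ->.
  rewrite in_setD1 eq_sym => /andP[xx0 x0X].
  have [x1] : exists x1, x1 \in X :\ x :\ x0.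
    by apply/set0Pn; rewrite -card_gt0 card_minus2.
  rewrite !in_setD1 eq_sym => /and3P[x01 x1x x1X].
  have f : [set x; x0; x1] \in F by apply: XFt; rewrite // eq_sym.
  have [xx0' _ _] := tri_adj F3 f.
  have /connectP[p] := proj2 (triangulation_regular x tF) _ _ xx0' xy.
  elim: p x0 x0X {x01 f xx0 xx0'} => [|z p IH] t tX /=; first by move=> _ ->.
  case/andP=> tz; apply: IH; have [xt _ _] := tri_adj F3 tz.
  have : z \in thirds F x t by rewrite inE.
  by rewrite thX // !inE => /and3P[].
have vX x : x \in vertices F -> x \in X.
  have [f fX f3] : exists2 f : {set V}, f \subset X & #|f| = 3.
    have /card_geqP[s [us ss sX]] : 3 <= #|X| by rewrite X4.
    by exists [set x in s]; [apply/subsetP=> y; rewrite inE => /sX | rewrite cardsE (card_uniqP us)].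
  have [y0 y0f] : exists y, y \in f by apply/set0Pn; rewrite -card_gt0 f3.
  have y0X := subsetP fX y0 y0f.
  have y0F : y0 \in vertices F by apply/bigcupP; exists f; rewrite ?XF.
  move=> xF; case: tF => _ _ _ _ /(_ _ _ y0F xF) /connectP[p].
  elim: p y0 y0X {y0F y0f} => [|z p IH] y yX /=; first by move=> _ ->.
  by case/andP=> yz; apply: IH; apply: adjX yz.
suff -> : F = [set f : {set V} | f \subset X & #|f| == 3] by apply: tetrahedron_spherical.
apply/setP=> f; rewrite inE; apply/idP/andP=> [fF|[fX /eqP]]; last exact: XF.
rewrite F3 //; split=> //; apply/subsetP=> x xf; apply: vX.
by apply/bigcupP; exists f.
Qed.

End Tetrahedron.

(** * Orientability under contraction *)

Section Orientations.
Variable V : finType.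
Implicit Types (F : {set {set V}}) (x y z t : V) (o : V -> V -> V -> bool).

(** Coherence stated as an equation between the two faces on an edge, so that signs can be computed
    by rewriting. *)
Definition orientation F o :=
  (forall x y z, [set x; y; z] \in F -> o x y z = o y z x /\ o y x z = ~~ o x y z) /\
  (forall x y z t, [set x; y; z] \in F -> [set x; y; t] \in F -> z != t ->
     o x y t = ~~ o x y z).

Lemma orientableP F : orientable F <-> exists o, orientation F o.
Proof.
split=> -[o [S C]]; exists o; split.
- by move=> x y z f; have [-> ->] := S _ _ _ f; rewrite negbK.
- move=> x y z t f g zt; have [_ fs] := S _ _ _ f; have [_ gs] := S _ _ _ g.
  case oz: (o x y z); case ot: (o x y t) => //; case/eqP: zt.
    exact: C f g oz ot.
  by apply: (C y x); rewrite 1?set3C //; apply: negbNE; rewrite -?fs -?gs ?oz ?ot.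
- by move=> x y z f; have [-> ->] := S _ _ _ f; rewrite negbK.
move=> x y z t f g oz ot; apply/eqP; apply: contraTT ot => zt.
by rewrite (C _ _ _ _ f g zt) oz.
Qed.

Lemma orientation_rot F o x y z : orientation F o -> [set x; y; z] \in F ->
  o x y z = o y z x.
Proof. by case=> S _ /S[]. Qed.

Lemma orientation_swap F o x y z : orientation F o -> [set x; y; z] \in F ->
  o y x z = ~~ o x y z.
Proof. by case=> S _ /S[]. Qed.

End Orientations.

Section ContractOrientation.
Variables (V : finType) (F : {set {set V}}) (a c : V).
Hypotheses (tF : triangulation F) (adjac : adj F a c) (lac : cycles_facial F a c).
Hypothesis no_opposite : forall p q, [set a; p; q] \in F -> [set c; p; q] \in F -> False.
Implicit Types (x y z p q s t : V).
Local Notation F' := (contract F a c).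
Local Notation h := (glue a c).
Local Notation k := (unglue a c).

Let F3 : only_triangles F. Proof. by case: tF. Qed.
Let ac : a != c := adj_neq adjac.

(** Each face takes the sign of the face that it comes from. *)
Lemma orientable_contract : orientable F -> orientable F'.
Proof.
move=> /orientableP[o O]; have [S C] := O.
apply/orientableP; exists (fun x y z => if [set x; y; z] \in F then o x y z else o (k x) (k y) (k z)).
split=> [x y z|x y z t].
  rewrite mem_contract // => /and4P[_ _ _].
  by rewrite -(set3_rot x y z) (set3C y x); case: ifP => [f _|_ /= f]; apply: S.
have kI s u : s != c -> u != c -> s != u -> k s != k u.
  rewrite /unglue => sc uc su; case: (s =P a) => sa; case: (u =P a) => ua //.
  - by rewrite sa ua eqxx in su.
  - by rewrite eq_sym.
rewrite !mem_contract // => /and4P[xc yc zc fz] /and4P[_ _ tc ft] zt.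
(* The mixed case: xyu is a face of F and xyv comes from a face through c. If one of x, y is a, the
   other one forms a face with a and c, as ac is good, and the two signs are compared through that
   face. *)
suff M u v : u != c -> v != c -> [set x; y; u] \in F -> [set x; y; v] \notin F ->
    [set k x; k y; k v] \in F -> o (k x) (k y) (k v) = ~~ o x y u.
  case: ifP ft => [f _|/negbT nf /= f]; case: ifP fz => [g _|/negbT ng /= g].
  - exact: C zt.
  - by rewrite (M t z) // negbK.
  - exact: M.
  - by apply: C => //; apply: kI.
move=> uc vc f nf g.
have fac w : [set a; c; w] \in F ->
    [/\ o a w c = ~~ o a c w, o c w a = o a c w, o w a c = o a c w & o w c a = ~~ o a c w].
  move=> h1; have h2 : [set w; a; c] \in F by rewrite set3_rot.
  have h3 : [set c; a; w] \in F by rewrite set3C.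
  have h4 : [set w; c; a] \in F by rewrite set3_rot.
  have e : o w a c = o a c w := orientation_rot O h2.
  have e' : o w c a = o c a w := orientation_rot O h4.
  have e2 : o c w a = ~~ o w c a := orientation_swap O h4.
  have e3 : o c a w = ~~ o a c w := orientation_swap O h1.
  rewrite e2 e' e3 e negbK; split=> //.
  by rewrite (orientation_swap O h2) e.
have [_ kxv kyv] := tri_neq F3 g.
have [adjxy adjxu adjyu] := tri_adj F3 f; have [adjxy' _ _] := tri_adj F3 g.
have kid w : w != a -> k w = w by rewrite /unglue => /negPf->.
have ka : k a = c by rewrite /unglue eqxx.
case: (x =P a) => [xa|/eqP xa].
  rewrite xa ka in f g kxv adjxy adjxy' *.
  have va : v != a by apply: contraNneq kxv => ->; rewrite ka.
  have ya : y != a by rewrite eq_sym (adj_neq adjxy).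
  rewrite !kid // in g adjxy' *.
  have acy : [set a; c; y] \in F by apply: (cycles_facialP _ _ _ lac).
  have [E1 E2 _ _] := fac _ acy.
  have cya : [set c; y; a] \in F by rewrite set3_rot set3_rot.
  have ayc : [set a; y; c] \in F by rewrite set3AC.
  rewrite eq_sym in va; rewrite eq_sym in uc.
  by rewrite (C _ _ _ _ cya g va) (C _ _ _ _ ayc f uc) E1 E2 negbK.
case: (y =P a) => [ya|/eqP ya].
  rewrite ya ka in f g kyv adjxy adjxy' *.
  have va : v != a by apply: contraNneq kyv => ->; rewrite ka.
  rewrite !kid // in g adjxy' *.
  have acx : [set a; c; x] \in F.
    by apply: (cycles_facialP _ _ _ lac); rewrite adj_sym.
  have [_ _ E1 E2] := fac _ acx.
  have xca : [set x; c; a] \in F by rewrite set3AC set3_rot.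
  have xac : [set x; a; c] \in F by rewrite set3_rot.
  rewrite eq_sym in va; rewrite eq_sym in uc.
  by rewrite (C _ _ _ _ xca g va) (C _ _ _ _ xac f uc) E1 E2 negbK.
case: (v =P a) => [va|/eqP va].
  rewrite va (kid _ xa) (kid _ ya) ka in g *; exact: C f g uc.
by case/negP: nf; rewrite !kid in g.
Qed.

(** Successive faces around a share an edge at a, and coherence makes them turn the same way around
    a. *)
Lemma orientation_along_fan o x y (p : seq V) d : orientation F' o ->
  path (fun s t => [&& link F a s t, s != c & t != c]) x (y :: p) ->
  uniq [:: x, y & p] -> last y p = d ->
  exists t, [/\ [set a; t; d] \in F, t != c & o a t d = o a x y].
Proof.
move=> O; have inF' s t : [set a; s; t] \in F -> s != c -> t != c -> [set a; s; t] \in F'.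
  by move=> f sc tc; rewrite mem_contract // ac sc tc f.
elim: p x y => [|z p IH] x y.
  by move=> /= /andP[/and3P[f xc yc] _] _ <-; exists x.
rewrite [path _ _ _]/= => /andP[/and3P[f xc yc] yzp] /andP[xyzp u] ld.
have [t [ft tc et]] := IH y z yzp u ld; exists t; split=> //; rewrite {}et.
move: yzp => /= /andP[/and3P[g _ zc] _].
have xz : x != z by move: xyzp; rewrite !inE !negb_or => /and3P[].
have f' : [set a; y; x] \in F' by apply: inF'; rewrite // set3AC.
have f2 : [set a; x; y] \in F' by apply: inF'.
have f3 : [set y; a; x] \in F' by rewrite set3C.
have f4 : [set x; y; a] \in F' by rewrite set3_rot.
rewrite (proj2 O _ _ _ _ f' (inF' _ _ g yc zc) xz) (orientation_swap O f3).
by rewrite negbK (orientation_rot O f2) (orientation_rot O f4).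
Qed.

(** Faces off ac inherit their signs through [glue]. The signs of acb and acd must agree with each
    other and with their neighbours; a fan of faces around a shows that the constraints at b and at
    d are compatible. *)
Lemma orientable_of_contract : orientable F' -> orientable F.
Proof.
move=> /orientableP[o O]; have C := proj2 O.
have inF' f x y z : f = [set x; y; z] -> f \in F -> ~~ ([set a; c] \subset f) ->
    [set h x; h y; h z] \in F'.
  by move=> ef fF nac; rewrite -imset3 -ef; apply: imset_f; rewrite inE fF.
have inF'a s t : [set a; s; t] \in F -> s != c -> t != c -> [set a; s; t] \in F'.
  by move=> f sc tc; rewrite mem_contract // ac sc tc f.
have inF'c s t : [set c; s; t] \in F -> s != a -> t != a -> [set a; s; t] \in F'.
  move=> f sa ta; have [cs ct _] := tri_neq F3 f; rewrite eq_sym in cs; rewrite eq_sym in ct.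
  by rewrite mem_contract // ac cs ct /unglue eqxx (negPf sa) (negPf ta) f orbT.
have [b [d [bd acbd]]] := common_thirds tF adjac.
have acx x : ([set a; c; x] \in F) = (x == b) || (x == d).
  by have /setP/(_ x) := acbd; rewrite !inE.
have acb : [set a; c; b] \in F by rewrite acx eqxx.
have acd : [set a; c; d] \in F by rewrite acx eqxx orbT.
have [_ ab cb] := tri_adj F3 acb; have [_ ad cd] := tri_adj F3 acd.
have ab' := adj_neq ab; have cb' := adj_neq cb.
have ad' := adj_neq ad; have cd' := adj_neq cd.
have only x t t' : adj F a x -> [set a; c; x] \in F -> [set a; x; t] \in F -> t != c ->
    [set a; x; t'] \in F -> t' != c -> t = t'.
  move=> ax acx' f tc g t'c; have : #|thirds F a x| = 2.
    by case: (triangulation_regular a tF) => + _; apply.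
  move/(@card2_eq _ _ c t); rewrite !inE set3AC acx' f eq_sym tc => /(_ isT isT isT).
  by move/setP/(_ t'); rewrite !inE g (negPf t'c) => /esym/eqP->.
have dc : d != c by rewrite eq_sym.
have db : d != b by rewrite eq_sym.
(* The arc of the link of a from b to d that avoids c. Its faces survive the contraction and carry
   the sign at b over to d. *)
have /connectP[p0 bp0] := link_minus tF adjac acbd bd dc ad.
case/shortenP: bp0 => p bp up _ ed.
case: p bp up ed => [|y0 p] bp up ed; first by rewrite ed /= eqxx in bd.
have [t0 [ft0 t0c eps]] := orientation_along_fan O bp up (esym ed).
have [aby yc] : [set a; b; y0] \in F /\ y0 != c by case/andP: bp => /and3P[].
set e := o a b y0 in eps.
(* The signs, in the contraction, of the neighbours of acb and acd: across ax here, across cx in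
   [V2]. *)
have V1 x t : [set a; c; x] \in F -> [set a; x; t] \in F -> t != c ->
    o a x t = (x == d) (+) e.
  move=> acx' f tc; have [_ ax _] := tri_adj F3 acx'.
  have xc : x != c by rewrite eq_sym; case: (tri_neq F3 acx').
  move: (acx'); rewrite acx => /orP[]/eqP ex; subst x.
    by rewrite (only _ _ _ ax acx' f tc aby yc) (negPf bd).
  rewrite eqxx; have g : [set a; d; t0] \in F by rewrite set3AC.
  rewrite (only _ _ _ ax acx' f tc g t0c).
  have g' := inF'a _ _ ft0 t0c xc.
  rewrite (orientation_rot O (inF'a _ _ g xc t0c)) (orientation_rot O); last first.
    by rewrite -(set3_rot a) inF'a.
  by rewrite (orientation_swap O g') eps.
have V2 x t : [set a; c; x] \in F -> [set c; x; t] \in F -> t != a ->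
    o a x t = ~~ ((x == d) (+) e).
  move=> acx' f ta; have [_ ax _] := tri_adj F3 acx'.
  have [_ xa' xc'] := tri_neq F3 acx'.
  have xa : x != a by rewrite eq_sym.
  have xc : x != c by rewrite eq_sym.
  have [t1 g t1c] : exists2 t1, [set a; x; t1] \in F & t1 != c.
    have /card_gt0P[t1] : 0 < #|thirds F a x :\ c|.
      have : #|thirds F a x| = 2 by case: (triangulation_regular a tF) => + _; apply.
      by rewrite (cardsD1 c) inE set3AC acx' => -[]; rewrite add0n => ->.
    by rewrite !inE => /andP[t1c g]; exists t1.
  rewrite -(V1 _ _ acx' g t1c); apply: C (inF'a _ _ g xc t1c) (inF'c _ _ f xa ta) _.
  by apply/eqP=> et; rewrite et in g; apply: no_opposite g f.
(* [pos] says that c directly follows a in the cyclic order u, v, w. *)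
pose pos u v w := [|| (u == a) && (v == c), (v == a) && (w == c) | (w == a) && (u == c)].
pose sp u v w := [set a; c] \subset [set u; v; w].
have spE u v w : sp u v w = (a \in [set u; v; w]) && (c \in [set u; v; w]).
  by rewrite /sp subUset !sub1set.
have ha : h a = a by rewrite glue_id.
have hc : h c = a by rewrite /glue eqxx.
(* The two faces on ac get the signs forced by their neighbours: e for (a, c, b) and its negation
   for (a, c, d). *)
pose o2 u v w := if sp u v w then pos u v w (+) (d \in [set u; v; w]) (+) ~~ e
                 else o (h u) (h v) (h w).
have ca : c == a = false by rewrite eq_sym (negPf ac).
have ca' := negPf ac.
have da : d == a = false by rewrite eq_sym (negPf ad').
have dc' := negPf dc.
have M x z t v : [set x; z; t] \in F -> [set x; z; v] \in F -> sp x z t -> ~~ sp x z v ->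
    o2 x z v = ~~ o2 x z t.
  move=> f g s1 s2; rewrite /o2 s1 (negPf s2).
  have [xz xt zt] := tri_neq F3 f; have [_ xv zv] := tri_neq F3 g.
  have hid w : w != c -> h w = w by apply: glue_id.
  move: s1 s2; rewrite !spE !inE -!orbA => /andP[A B].
  case/or3P: A => /eqP ea; case/or3P: B => /eqP ec.
  - by move: ac; rewrite ea ec eqxx.
  - by rewrite -ea -ec !eqxx !orbT.
  - rewrite -ea -ec in f g xz xt zt xv * => N.
    have vc : v != c by apply: contraNneq N => ->; rewrite !eqxx ?orbT.
    have f' : [set a; c; z] \in F by rewrite set3AC.
    rewrite ha !hid // (V1 z v f' g vc) /pos ?inE.
    rewrite da dc' ca (negPf zt) (eq_sym z a) (negPf xz) !andbF !orbF /= (eq_sym d z).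
    by case: (z == d); case: (e).
  - by rewrite -ea -ec !eqxx !orbT.
  - by move: ac; rewrite ea ec eqxx.
  - rewrite -ea -ec in f g xz xt zt zv * => N.
    have vc : v != c by apply: contraNneq N => ->; rewrite !eqxx ?orbT.
    have f' : [set a; c; x] \in F by rewrite set3_rot set3_rot.
    have g' : [set a; x; v] \in F by rewrite set3C.
    rewrite ha !hid // (orientation_swap O (inF'a _ _ g' xt vc)) (V1 x v f' g' vc) /pos ?inE.
    rewrite da dc' !eqxx (negPf xz) orbF /= (eq_sym d x).
    by case: (x == d); case: (e).
  - rewrite -ea -ec in f g xz xt zt xv * => N.
    have va : v != a by apply: contraNneq N => ->; rewrite !eqxx ?orbT.
    have f' : [set a; c; z] \in F by rewrite set3_rot.
    have zc : z != c by rewrite eq_sym.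
    have vc : v != c by rewrite eq_sym.
    rewrite hc !hid // (V2 z v f' g va) /pos ?inE.
    rewrite da dc' !eqxx !orbT /= orbF (eq_sym d z).
    by case: (z == d); case: (e).
  - rewrite -ea -ec in f g xz xt zt zv * => N.
    have va : v != a by apply: contraNneq N => ->; rewrite !eqxx ?orbT.
    have f' : [set a; c; x] \in F by rewrite set3_rot set3_rot set3AC.
    have g' : [set c; x; v] \in F by rewrite set3C.
    have vc : v != c by rewrite eq_sym.
    rewrite hc !hid // (orientation_swap O (inF'c _ _ g' xt va)) (V2 x v f' g' va) /pos ?inE.
    rewrite da dc' ca' (negPf xt) (negPf xz) ca /= !andbF !orbF (eq_sym d x).
    by case: (x == d); case: (e).
  by move: ac; rewrite ea ec eqxx.
have N2 (u v w : V) : u != v -> ~~ ((u == w) && (v == w)).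
  by apply: contra => /andP[/eqP-> /eqP->].
have N3 u : ~~ ((u == a) && (u == c)).
  by apply/negP=> /andP[/eqP->]; rewrite ca'.
apply/orientableP; exists o2; split=> [x y z f|x y z t f g zt].
  rewrite /o2 /sp (set3C y x) -(set3_rot x y z).
  have [xy xz yz] := tri_neq F3 f.
  case: ifP => [|/negbT ns]; last by apply: (proj1 O); apply: inF' ns.
  rewrite -/(sp x y z) spE !inE -!orbA => /andP[A B]; split.
    by congr (_ (+) _ (+) _); rewrite /pos orbC -orbA.
  rewrite -!addbA -addNb; congr (_ (+) _).
  move: (N2 _ _ a xy) (N2 _ _ a xz) (N2 _ _ a yz) (N2 _ _ c xy) (N2 _ _ c xz) (N2 _ _ c yz).
  move: (N3 x) (N3 y) (N3 z) A B; rewrite /pos !(eq_sym a) !(eq_sym c).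
  by case: (x == a); case: (y == a); case: (z == a); case: (x == c); case: (y == c); case: (z == c).
have [xy xz yz] := tri_neq F3 f; have [_ xt yt] := tri_neq F3 g.
case s1: (sp x y z); case s2: (sp x y t).
(* Two faces on xy that both contain a and c are acb and acd, with xy = ac. *)
- have : (x == a) && (y == c) || (x == c) && (y == a).
    move: (N2 _ _ a xy) (N2 _ _ a xz) (N2 _ _ a yz) (N2 _ _ c xy) (N2 _ _ c xz) (N2 _ _ c yz).
    move: (N2 _ _ a xt) (N2 _ _ a yt) (N2 _ _ a zt) (N2 _ _ c xt) (N2 _ _ c yt) (N2 _ _ c zt).
    move: (N3 x) (N3 y) (N3 z) (N3 t) s1 s2; rewrite !spE !inE !(eq_sym a) !(eq_sym c).
    by case: (x == a); case: (y == a); case: (z == a); case: (x == c); case: (y == c);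
       case: (z == c); case: (t == a); case: (t == c).
  have fin : [set a; c; z] \in F -> [set a; c; t] \in F -> (d == t) = ~~ (d == z).
    rewrite !acx !(eq_sym d); case: (z =P d) => [ezd|_] /=.
      by rewrite -ezd (eq_sym t z) (negPf zt).
    rewrite orbF => /eqP ezb; rewrite -ezb (eq_sym t z) (negPf zt) /= => ->; done.
  rewrite /o2 s1 s2 => xyE.
  suff -> : pos x y t (+) (d \in [set x; y; t]) = ~~ (pos x y z (+) (d \in [set x; y; z])).
    by rewrite addNb.
  case/orP: xyE => /andP[/eqP ex /eqP ey]; rewrite ex ey in f g xz yz xt yt *.
    by rewrite /pos !inE !eqxx da dc' /= (fin f g).
  rewrite set3C in f; rewrite set3C in g.
  rewrite /pos !inE !eqxx da dc' ca /= !(eq_sym _ a) !(eq_sym _ c).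
  by rewrite (negPf xz) (negPf yz) (negPf xt) (negPf yt) ?ca ?ca' /= (fin f g).
- by apply: M; rewrite ?s1 ?s2.
- by rewrite (M x y t z) ?s1 ?s2 // negbK.
rewrite /o2 s1 s2; apply: C.
- by apply: (inF' _ x y z erefl f); rewrite -/(sp x y z) s1.
- by apply: (inF' _ x y t erefl g); rewrite -/(sp x y t) s2.
apply/eqP=> /glue_eq[e1|[e1 e2]|[e1 e2]].
- by rewrite e1 eqxx in zt.
- by apply: (no_opposite (p := x) (q := y)); rewrite set3_rot -?e1 -?e2.
by apply: (no_opposite (p := x) (q := y)); rewrite set3_rot -?e1 -?e2.
Qed.

End ContractOrientation.

(** If apq and cpq are faces, then so are acp and acq because ac is good, and the four form a
    tetrahedron, which is excluded with the sphere. *)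
Lemma cycles_facial_contractible (V : finType) (F : {set {set V}}) (a c : V) :
  triangulation F -> ~ spherical F -> adj F a c -> cycles_facial F a c ->
  contractible F a c.
Proof.
move=> tF nS adjac lac; have F3 : only_triangles F by case: tF.
have no_opposite p q : [set a; p; q] \in F -> [set c; p; q] \in F -> False.
  move=> f g; apply: nS.
  have [ap aq pq] := tri_adj F3 f; have [cp cq _] := tri_adj F3 g.
  have f1 := cycles_facialP _ _ _ lac _ ap cp.
  have f2 := cycles_facialP _ _ _ lac _ aq cq.
  have [ac ap' aq' pq'] : [/\ a != c, a != p, a != q & p != q].
    by split; apply: (@adj_neq _ F).
  have [cp' cq'] := (adj_neq cp, adj_neq cq).
  apply: (@triangulation_tetrahedron _ F [set a; c; p; q]) => //.
    rewrite -setUA -setUA !cardsU1 cards1 !inE !negb_or.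
    by rewrite ac ap' aq' cp' cq' pq'.
  move=> k kX k3.
  have [y yX yk] : exists2 y, y \in [set a; c; p; q] & y \notin k.
    apply/subsetPn/negP=> /subset_leq_card; rewrite k3.
    rewrite -setUA -setUA !cardsU1 cards1 !inE !negb_or.
    by rewrite ac ap' aq' cp' cq' pq'.
  have kE k' : k' \in F -> k \subset k' -> k \in F.
    by move=> k'F kk'; suff -> : k = k' by []; apply/eqP; rewrite eqEcard kk' k3 F3.
  have kY t : t \in k -> (t \in [set a; c; p; q]) && (t != y).
    by move=> tk; rewrite (subsetP kX) //=; apply: contraNneq yk => <-.
  move: yX; rewrite !inE -!orbA => /or4P[]/eqP ey; [apply: kE g _ | apply: kE f _ | apply: kE f2 _ | apply: kE f1 _];
    apply/subsetP=> t /kY; rewrite ey !inE -!orbA => /andP[/or4P[]/eqP->];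
    by rewrite ?eqxx ?orbT.
split=> //; first exact: contract_triangulation.
split; first exact: contract_euler_char.
by split; [apply: orientable_of_contract | apply: orientable_contract].
Qed.

(** * The cut/cap operation *)

Section Cap.
Variable V : finType.
Implicit Types (X Y Z : cut_vertex V) (i j : 'I_3) (b : bool).

(** A uniform name for u'_i, with false, and v'_i, with true. *)
Definition copy (k : 'I_3 * bool) : cut_vertex V := inl (inr k).

Lemma copy_inj : injective copy.
Proof. by move=> k l []. Qed.

(* Numbers the frame vertices: the boundary hexagon is 0 .. 5. *)
Definition code X : nat :=
  match X with
  | inl (inr (i, b)) => i + 3 * b
  | inr _ => 6
  | inl (inl _) => 7
  end.

(** All old vertices share the code 7, so codes identify vertices only below it. *)
Lemma eq_code X Y : code Y < 7 -> (X == Y) = (code X == code Y).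
Proof.
move=> Y7; apply/eqP/eqP=> [->//|].
case: X => [[x|[[i ip] b]]|[]]; case: Y Y7 => [[y|[[j jp] b']]|[]] //= _.
- by case: j jp b' => [|[|[|]]] ? [].
- case: i ip b => [|[|[|//]]] ip []; case: j jp b' => [|[|[|//]]] jp [] //= _;
  by congr (inl (inr (_, _))); apply: val_inj.
- by case: i ip b => [|[|[|//]]] ip [].
by case: j jp b' => [|[|[|]]] ? [].
Qed.

Definition cap_codes (one : bool) : seq (seq nat) :=
  if one then [:: [:: 6; 0; 1]; [:: 6; 1; 2]; [:: 6; 2; 3];
                  [:: 6; 3; 4]; [:: 6; 4; 5]; [:: 6; 5; 0]]
  else [:: [:: 0; 1; 2]; [:: 3; 4; 5]].

(** Turns equality of triples into a computation on codes, so that facts about the cap follow by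
    enumeration. *)
Lemma set3_eq (A B C X Y Z : cut_vertex V) :
  code A < 7 -> code B < 7 -> code C < 7 -> uniq [:: code A; code B; code C] ->
  ([set X; Y; Z] == [set A; B; C]) = [&& X != Y, X != Z, Y != Z &
    all (fun n => n \in [:: code A; code B; code C]) [:: code X; code Y; code Z]].
Proof.
move=> A7 B7 C7 U.
have M T : (T \in [set A; B; C]) = (code T \in [:: code A; code B; code C]).
  by rewrite !inE !eq_code // -orbA.
have ABC : #|[set A; B; C]| = 3.
  apply/card_set3; move: U; rewrite /= !inE negb_or !andbT => /andP[/andP[ab ac] bc].
  by split; rewrite eq_code.
apply/eqP/and4P=> [E|[XY XZ YZ /and4P[HX HY HZ _]]].
  have /card_set3[XY XZ YZ] : #|[set X; Y; Z]| = 3 by rewrite E.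
  by split=> //; apply/and4P; split=> //; rewrite -M -E !inE eqxx ?orbT.
apply/eqP; rewrite eqEcard ABC; have /card_set3-> : [/\ X != Y, X != Z & Y != Z] by [].
rewrite andbT; apply/subsetP=> T; rewrite [T \in [set X; Y; Z]]inE inE !inE -orbA.
by case/or3P=> /eqP->; rewrite -?M // in HX HY HZ; move: HX HY HZ; rewrite !inE.
Qed.

Lemma mem_cap one X Y Z : ([set X; Y; Z] \in cap V one) =
  [&& X != Y, X != Z, Y != Z & has (fun l =>
     all (fun n => n \in l) [:: code X; code Y; code Z]) (cap_codes one)].
Proof.
rewrite /cap; case: one; rewrite !inE !set3_eq //=.
  by case: (X != Y); case: (X != Z); case: (Y != Z); rewrite //= ?andbF ?orbF -?orbA.
by case: (X != Y); case: (X != Z); case: (Y != Z); rewrite //= ?andbF ?orbF -?orbA.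
Qed.

Lemma cap_only_triangles one : only_triangles (cap V one).
Proof.
have H A B C : code A < 7 -> code B < 7 -> code C < 7 ->
    uniq [:: code A; code B; code C] -> #|[set A; B; C]| = 3.
  move=> A7 B7 C7 U; apply/card_set3; move: U; rewrite /= !inE negb_or !andbT.
  by move=> /andP[/andP[ab ac] bc]; split; rewrite eq_code.
move=> f; rewrite /cap; case: one; rewrite !inE -?orbA.
  by case/or4P=> [|||/or3P[]] /eqP->; apply: H.
by case/orP=> /eqP->; apply: H.
Qed.

(* Whether the boundary edge over w_i w_j joins the b-copy of w_i to the
   b'-copy of w_j; only w_3 w_1 (where [i + j = 2]) may switch sides. *)
Definition consecutive one i b j b' :=
  (i != j) && ((b (+) b') == one && (i + j == 2)).

(** In the two-sided case the remaining index is 3 - i - j, because the indices are 0, 1 and 2. *)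
Definition cap_apex one i j b : cut_vertex V :=
  if one then t' else copy (inord (3 - i - j), b).

Lemma mem_cap_copies one i b j b' Z : consecutive one i b j b' ->
  ([set copy (i, b); copy (j, b'); Z] \in cap V one) = (Z == cap_apex one i j b).
Proof.
move=> C; have /andP[ij _] := C; move: C.
have a7 : code (cap_apex one i j b) < 7.
  rewrite /cap_apex; case: one => //=; set k := inord _.
  by case: k b => [[|[|[|//]]] ?] [].
rewrite (eq_code _ a7) mem_cap ![_ == Z]eq_sym; clear a7.
have c7 k : code (copy k) < 7 by case: k => -[[|[|[|//]]] ?] [].
rewrite !eq_code //.
have -> : code (cap_apex one i j b) = if one then 6 else 3 - i - j + 3 * b.
  rewrite /cap_apex; case: one => //=; rewrite inordK //.
  by move: ij; case: i => -[|[|[|//]]] ?; case: j => -[|[|[|//]]] ?.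
rewrite /consecutive; clear ij; move: (code Z) => n; case: i => -[|[|[|//]]] ip; case: j => -[|[|[|//]]] jp;
  case: one; case: b; case: b' => //=;
  by case: n => [|[|[|[|[|[|[|n]]]]]]].
Qed.

Lemma consecutive_adj one i b j b' :
  consecutive one i b j b' -> adj (cap V one) (copy (i, b)) (copy (j, b')).
Proof.
by move=> /mem_cap_copies H; apply/(adjP3 (@cap_only_triangles one)); eexists; rewrite H.
Qed.

Lemma adj_consecutive one i b j b' :
  adj (cap V one) (copy (i, b)) (copy (j, b')) -> consecutive one i b j b'.
Proof.
case/(adjP3 (@cap_only_triangles one)) => Z; rewrite mem_cap.
have c7 k : code (copy k) < 7 by case: k => -[[|[|[|//]]] ?] [].
rewrite ![_ == Z]eq_sym !eq_code //.
rewrite /consecutive; move: (code Z) => n; case: i => -[|[|[|//]]] ip; case: j => -[|[|[|//]]] jp;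
  case: one; case: b; case: b' => //=;
  by case: n => [|[|[|[|[|[|[|n]]]]]]].
Qed.

(** With uniqueness below: a copy of w_j is joined on the boundary to exactly one of the two copies
    of w_i. *)
Lemma consecutive_negb one i b j b' :
  i != j -> consecutive one i b j b' || consecutive one i (~~ b) j b'.
Proof. by rewrite /consecutive => -> /=; case: b; case: b'; case: (one && _). Qed.

Lemma consecutive_unique one i b j b' :
  consecutive one i b j b' -> consecutive one i (~~ b) j b' -> False.
Proof. by rewrite /consecutive => /andP[_ +] /andP[_]; case: b; case: b'; case: (one && _). Qed.

Lemma old_cap one x : old x \notin vertices (cap V one).
Proof.
apply/bigcupP=> -[f]; rewrite /cap; case: one; rewrite !inE -?orbA.
  by case/or4P=> [|||/or3P[]] /eqP->; rewrite !inE.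
by case/orP=> /eqP->; rewrite !inE.
Qed.

Lemma copy_cap one k : copy k \in vertices (cap V one).
Proof.
suff [l] : exists l, adj (cap V one) (copy k) (copy l) by apply: adj_vertex.
case: k => i b; pose j : 'I_3 := if i == i1 then i2 else i1.
have ij : i != j by rewrite /j; case: (i =P i1) => [->|/eqP].
have /orP[C|C] := consecutive_negb one b true ij; first by exists (j, true); apply: consecutive_adj.
exists (j, false); apply: consecutive_adj; move: C.
by rewrite /consecutive; case: b; case: (_ && _); rewrite ?andbF.
Qed.

End Cap.

(** * Local structure after cutting and capping *)

Section CutCap.
Variables (V : finType) (T : {set {set V}}) (w : 'I_3 -> V).
Variables (one : bool) (s : {set V} -> 'I_3 -> bool).
Hypotheses (tT : triangulation T) (cycw : three_cycle T w).
Hypotheses (nonsep : nonseparating T w) (sides : side_labelling T w one s).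
Implicit Types (f g : {set V}) (x y z : V) (X Y Z : cut_vertex V) (i j : 'I_3) (b : bool).

Local Notation T' := (cut_cap T w one s).
Local Notation copy := (@copy V).
Local Notation W := [set w i | i : 'I_3].

Let T3 : only_triangles T. Proof. by case: tT. Qed.
Let deg2 x y : adj T x y -> #|thirds T x y| = 2.
Proof. by case: (triangulation_regular x tT) => + _; apply. Qed.

Lemma cycle_inj : injective w.
Proof. by move=> i j e; apply/eqP; apply: contraT => /cycw; rewrite e adj_irr. Qed.

Definition lift_vertex f x : cut_vertex V :=
  if [pick i | w i == x] is Some i then (if s f i then v' i else u' i) else old x.

(* The value at t' is junk. *)
Definition project X : V :=
  match X with inl (inl x) => x | inl (inr (i, _)) => w i | inr _ => w i1 end.

Lemma cut_faceE f : cut_face w s f = lift_vertex f @: f.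
Proof. by []. Qed.

Lemma lift_cycle f i : lift_vertex f (w i) = copy (i, s f i).
Proof.
rewrite /lift_vertex; case: pickP => [j /eqP/cycle_inj->|/(_ i)]; last by rewrite eqxx.
by case: (s f i).
Qed.

Lemma lift_off f x : x \notin W -> lift_vertex f x = old x.
Proof.
move=> xW; rewrite /lift_vertex; case: pickP => // i /eqP e.
by case/negP: xW; rewrite -e imset_f.
Qed.

Lemma lift_cases f x : (exists2 i, x = w i & lift_vertex f x = copy (i, s f i)) \/
  x \notin W /\ lift_vertex f x = old x.
Proof.
case: (boolP (x \in W)) => [/imsetP[i _ ->]|xW]; first by left; exists i; rewrite ?lift_cycle.
by right; rewrite lift_off.
Qed.

Lemma lift_vertexK f : cancel (lift_vertex f) project.
Proof. by move=> x; case: (lift_cases f x) => [[i -> ->]|[_ ->]]. Qed.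

Lemma lift_t f x : lift_vertex f x <> t'.
Proof. by case: (lift_cases f x) => [[i _ ->]|[_ ->]]. Qed.

Lemma cut_cap_face k : k \in T' -> (exists2 f, f \in T & k = cut_face w s f) \/ k \in cap V one.
Proof. by case/setUP=> [/imsetP[f fT ->]|kc]; [left; exists f | right]. Qed.

Lemma cap_face k : k \in cap V one -> k \in T'.
Proof. by move=> kc; apply/setUP; right. Qed.

Lemma cut_face_in f : f \in T -> cut_face w s f \in T'.
Proof. by move=> fT; apply/setUP; left; apply: imset_f. Qed.

Lemma cap_adj X Y : adj (cap V one) X Y -> adj T' X Y.
Proof.
case/andP=> XY /existsP[k /andP[kc /andP[Xk Yk]]].
exact: adj_face (cap_face kc) Xk Yk XY.
Qed.

Lemma cut_cap_only_triangles : only_triangles T'.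
Proof.
move=> k /cut_cap_face[[f fT ->]|]; last exact: cap_only_triangles.
by rewrite cut_faceE card_imset ?T3 //; apply: can_inj (lift_vertexK f).
Qed.

Lemma mem_cut_face f X : X \in cut_face w s f = (project X \in f) && (X == lift_vertex f (project X)).
Proof.
apply/imsetP/andP=> [[x xf ->]|[Xf /eqP e]]; first by rewrite lift_vertexK.
by exists (project X).
Qed.

Lemma cut_face_set3 f X Y Z : [set X; Y; Z] = cut_face w s f ->
  [/\ f = [set project X; project Y; project Z], X = lift_vertex f (project X),
      Y = lift_vertex f (project Y) & Z = lift_vertex f (project Z)].
Proof.
move=> E; have M U : U \in [set X; Y; Z] -> U = lift_vertex f (project U).
  by rewrite E mem_cut_face => /andP[_ /eqP].
split; try by apply: M; rewrite !inE eqxx ?orbT.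
rewrite -imset3 E cut_faceE -imset_comp -[LHS]imset_id.
by apply: eq_imset => x /=; rewrite lift_vertexK.
Qed.

Lemma lift_face f x y z : f \in T -> f = [set x; y; z] ->
  [set lift_vertex f x; lift_vertex f y; lift_vertex f z] \in T'.
Proof. by move=> fT e; rewrite -imset3 -[in X in _ @: X]e; apply: cut_face_in. Qed.

Lemma face_common_edge f g x y : f \in T -> g \in T -> f != g -> x != y ->
  x \in f -> y \in f -> x \in g -> y \in g -> f :&: g = [set x; y].
Proof.
move=> fT gT fg xy xf yf xg yg; apply/esym/eqP; rewrite eqEcard cards2 xy.
apply/andP; split; first by apply/subsetP=> t /set2P[]->; rewrite inE ?xf ?yf.
rewrite -ltnS -(T3 fT); apply: proper_card; rewrite properEneq subsetIl andbT.
apply: contra fg => /eqP/setIidPl sub; rewrite eqEcard sub T3 // T3 //.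
Qed.

(** Distinct f and g share the edge xy, which is off the cycle, and sides at y do not change across
    such an edge. *)
Lemma lift_indep f g x y : f \in T -> g \in T -> x \notin W -> x != y ->
  x \in f -> y \in f -> x \in g -> y \in g -> lift_vertex f y = lift_vertex g y.
Proof.
move=> fT gT xW xy xf yf xg yg; case: (f =P g) => [->//|/eqP fg].
case: (boolP (y \in W)) => [/imsetP[i _ yi]|yW]; last by rewrite !lift_off.
have fgE := face_common_edge fT gT fg xy xf yf xg yg.
have [S _] := sides; have := S f g i fT gT.
rewrite fgE cards2 xy !inE yi eqxx orbT => /(_ erefl isT).
have -> : on_cycle w [set x; w i] = false.
  by apply: contraNF xW => /subsetP/(_ x); apply; rewrite !inE eqxx.
by rewrite !lift_cycle => /eqP->.
Qed.

(* The copy of y next to the vertex x off the cycle. *)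
Definition lift_near x y := lift_vertex (odflt set0 [pick f in T | (x \in f) && (y \in f)]) y.

Lemma lift_nearE f x y : f \in T -> x \notin W -> x != y -> x \in f -> y \in f ->
  lift_near x y = lift_vertex f y.
Proof.
move=> fT xW xy xf yf; rewrite /lift_near; case: pickP => [g /=|/(_ f)]; last by rewrite /= fT xf yf.
by case/and3P=> gT xg yg; apply: lift_indep gT fT xW xy xg yg xf yf.
Qed.

Lemma lift_nearK x : cancel (lift_near x) project.
Proof. by move=> y; apply: lift_vertexK. Qed.

Lemma lift_near_off x y : y \notin W -> lift_near x y = old y.
Proof. exact: lift_off. Qed.

Lemma lift_near_cycle x i : exists b, lift_near x (w i) = copy (i, b).
Proof. by eexists; apply: lift_cycle. Qed.

(** With its inverse below: cutting leaves the star of a vertex off the cycle intact, up to the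
    choice of copies. *)
Lemma near_face x y z : x \notin W -> [set x; y; z] \in T ->
  [set old x; lift_near x y; lift_near x z] \in T'.
Proof.
move=> xW f; have [xy xz _] := tri_neq T3 f.
have := lift_face f erefl; rewrite lift_off //.
by rewrite -!(lift_nearE f xW) // !inE eqxx ?orbT.
Qed.

Lemma near_face_inv x Y Z : [set old x; Y; Z] \in T' ->
  [/\ x \notin W, [set x; project Y; project Z] \in T,
      Y = lift_near x (project Y) & Z = lift_near x (project Z)].
Proof.
move=> F; case: (cut_cap_face F) => [[f fT]|C]; last first.
  case/negP: (old_cap one x); apply/bigcupP; eexists; first exact: C.
  by rewrite !inE eqxx.
case/cut_face_set3=> fE; rewrite /= => ex eY eZ; rewrite fE in fT.
have [xy xz _] := tri_neq T3 fT.
have xW : x \notin W.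
  by case: (lift_cases f x) ex => [[i -> ->]|[]].
by split=> //; rewrite [LHS](eY, eZ) fE (lift_nearE fT) // !inE eqxx ?orbT.
Qed.

Lemma near_adj x y : x \notin W -> adj T x y -> adj T' (old x) (lift_near x y).
Proof.
by move=> xW /(adjP3 T3)[z f]; case: (tri_adj cut_cap_only_triangles (near_face xW f)).
Qed.

Lemma near_adj_inv x Y : adj T' (old x) Y ->
  [/\ x \notin W, adj T x (project Y) & Y = lift_near x (project Y)].
Proof.
case/(adjP3 cut_cap_only_triangles)=> Z /near_face_inv[xW f eY _]; split=> //.
by case: (tri_adj T3 f).
Qed.

Lemma interior_old X Y : adj T' X Y -> X \notin vertices (cap V one) ->
  exists2 x, X = old x & x \notin W.
Proof.
case: X => [[x|k]|[]] XY Xc.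
- by exists x => //; case: (near_adj_inv XY).
- by rewrite (copy_cap _ one k) in Xc.
case/andP: XY => _ /existsP[k /andP[/cut_cap_face[[f fT ->]|kc] /andP[tk _]]].
  by case/imsetP: tk => x _ /esym/lift_t.
by case/negP: Xc; apply/bigcupP; exists k.
Qed.

Lemma cut_cap_regular x : x \notin W -> regular_at T' (old x).
Proof.
move=> xW; split=> [Y /near_adj_inv[_ xy ->]|Y Z /near_adj_inv[_ xy ->] /near_adj_inv[_ xz ->]].
  set y := project Y in xy *; rewrite -(deg2 xy) -(card_imset _ (can_inj (lift_nearK x))).
  congr #|pred_of_set _|; apply/setP=> Z; rewrite inE; apply/idP/imsetP=> [/near_face_inv[_ + _ eZ]|].
    by rewrite lift_nearK => f; exists (project Z); rewrite ?inE.
  by case=> z; rewrite inE => f ->; apply: near_face.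
have := proj2 (triangulation_regular x tT) _ _ xy xz.
case/connectP=> p; elim: p (project Y) {xy} => [|t p IH] y /=; first by move=> _ ->.
case/andP=> f /IH{}IH /IH; apply: connect_trans; apply: connect1; exact: near_face.
Qed.

(** For distinct indices, i + j = 2 means the pair w_1, w_3 in either order, which removes the
    condition i < j of [side_labelling]. *)
Lemma sides_along f i j : f \in T -> w i \in f -> w j \in f -> i != j ->
  s f i (+) s f j = one && (i + j == 2).
Proof.
move=> fT wi wj; have [_ S] := sides.
have H k l : w k \in f -> w l \in f -> k < l -> s f k (+) s f l = one && (k + l == 2).
  move=> wk wl kl; rewrite S //; congr andb.
  by move: kl; case: k {wk} => -[|[|[|//]]] ?; case: l {wl} => -[|[|[|//]]] ?.
by rewrite -val_eqE /= neq_ltn => /orP[]; [exact: H | rewrite addbC addnC; exact: H].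
Qed.

Lemma lift_consecutive f i j : f \in T -> w i \in f -> w j \in f -> i != j ->
  consecutive one i (s f i) j (s f j).
Proof. by move=> fT wi wj ij; rewrite /consecutive ij sides_along ?eqxx. Qed.

Lemma adj_copies i b j b' :
  adj T' (copy (i, b)) (copy (j, b')) -> consecutive one i b j b'.
Proof.
case/andP=> XY /existsP[k /andP[kT /andP[Xk Yk]]].
case: (cut_cap_face kT) => [[f fT kE]|kc]; last first.
  by apply: adj_consecutive; apply: adj_face kc Xk Yk XY.
move: Xk Yk; rewrite kE !mem_cut_face /= !lift_cycle => /andP[wi /eqP[eb]] /andP[wj /eqP[eb']].
rewrite eb eb'; apply: lift_consecutive => //; apply: contraNneq XY => ij.
by rewrite eb eb' ij.
Qed.

(** A face with all its edges on the cycle has no neighbour for [across], so nonseparation fails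
    between it and the second face on one of its edges. *)
Lemma cycle_not_face f : f \in T -> exists2 x, x \in f & x \notin W.
Proof.
move=> fT; apply/subsetPn/negP=> fW.
have : 0 < #|f| by rewrite T3.
case/card_gt0P=> x xf; have [y] : exists y, y \in f :\ x.
  by apply/set0Pn; rewrite -card_gt0; move: (T3 fT); rewrite (cardsD1 x) xf => -[]; rewrite add0n => ->.
rewrite in_setD1 => /andP[yx yf].
have xy : adj T x y by apply: (adj_face fT); rewrite // eq_sym.
have := card_faces_thirds T3 (adj_neq xy); rewrite (deg2 xy) => c2.
have /set0Pn[g] : [set g in T | [set x; y] \subset g] :\ f != set0.
  rewrite -card_gt0; move: c2; rewrite (cardsD1 f) inE fT subUset !sub1set xf yf.
  by case; rewrite add0n => ->.
rewrite !inE => /and3P[gf gT _]; have /connectP[p] := nonsep fT gT.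
case: p => [_ e|h p /= /andP[/and4P[_ _ _ nc] _] _]; first by rewrite e eqxx in gf.
by case/negP: nc; apply: subset_trans (subsetIl _ _) fW.
Qed.

(** The two faces of T on w_i w_j lie on opposite sides, so exactly one of them is attached to a
    given boundary edge; the cap supplies the second. *)
Lemma copies_deg2 i b j b' : consecutive one i b j b' ->
  #|thirds T' (copy (i, b)) (copy (j, b'))| = 2.
Proof.
move=> C; have ij : i != j by case/andP: C.
have adjw := cycw ij; have wij := adj_neq adjw.
have [z1 [z2 [z12 th]]] : exists z1 z2, z1 != z2 /\ thirds T (w i) (w j) = [set z1; z2].
  by apply/cards2P; rewrite deg2.
have inT z : ([set w i; w j; z] \in T) = (z == z1) || (z == z2).
  by have /setP/(_ z) := th; rewrite !inE.
have F1 : [set w i; w j; z1] \in T by rewrite inT eqxx.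
have F2 : [set w i; w j; z2] \in T by rewrite inT eqxx orbT.
have opp : s [set w i; w j; z1] i != s [set w i; w j; z2] i.
  have fg : [set w i; w j; z1] != [set w i; w j; z2].
    have [_ n1 n2] := tri_neq T3 F1.
    apply/eqP=> /setP/(_ z1); rewrite !inE eqxx orbT (negPf z12) orbF.
    by rewrite eq_sym (negPf n1) eq_sym (negPf n2).
  have fgE := face_common_edge F1 F2 fg wij.
  have {}fgE : [set w i; w j; z1] :&: [set w i; w j; z2] = [set w i; w j].
    by apply: fgE; rewrite !inE eqxx ?orbT.
  have [S _] := sides; have := S _ _ i F1 F2.
  rewrite fgE cards2 wij !inE eqxx => /(_ erefl isT) ->.
  by rewrite negbK; apply/subsetP=> t /set2P[]->; apply: imset_f.
have [z [fT fb fu]] : exists z, [/\ [set w i; w j; z] \in T, s [set w i; w j; z] i = b &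
    forall t, [set w i; w j; t] \in T -> s [set w i; w j; t] i = b -> t = z].
  case: (s [set w i; w j; z1] i =P b) => [e|/eqP e].
    exists z1; split=> // t; rewrite inT => /orP[]/eqP-> // e2.
    by rewrite e e2 eqxx in opp.
  exists z2; split=> //.
    by move: opp e; case: (s _ i); case: (s _ i); case: b {C}.
  move=> t; rewrite inT => /orP[]/eqP-> // e2.
  by rewrite e2 eqxx in e.
set f := [set w i; w j; z] in fT fb.
have wif : w i \in f by rewrite !inE eqxx.
have wjf : w j \in f by rewrite !inE eqxx orbT.
have fb' : s f j = b'.
  have := lift_consecutive fT wif wjf ij; move: C; rewrite /consecutive ij /= fb => /eqP<-.
  by rewrite (inj_eq (can_inj (addKb b))) => /eqP.
have zW : z \notin W.
  have [x] := cycle_not_face fT; rewrite !inE -orbA => /or3P[]/eqP-> //.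
    by rewrite imset_f.
  by rewrite imset_f.
suff -> : thirds T' (copy (i, b)) (copy (j, b')) = [set old z; cap_apex V one i j b].
  by rewrite cards2 /cap_apex; case: (one).
apply/setP=> Z; rewrite in_set /cut_cap [in LHS]in_setU (mem_cap_copies _ C) in_set2.
congr orb; apply/imsetP/eqP=> [[g gT]|->].
  case/cut_face_set3=> /= gE; rewrite !lift_cycle => -[eb] _ eZ.
  rewrite gE in gT eb; have zE := fu _ gT (esym eb).
  by rewrite eZ gE zE lift_off.
exists f => //; have := imset3 (lift_vertex f) (w i) (w j) z.
by rewrite !lift_cycle fb fb' lift_off // => <-.
Qed.

Lemma near_deg2 x Y Z : adj T' (old x) Y -> adj T' (old x) Z -> adj T' Y Z ->
  #|thirds T' Y Z| = 2.
Proof.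
move=> /near_adj_inv[xW xy eY] /near_adj_inv[_ xz eZ] YZ.
set y := project Y in xy eY; set z := project Z in xz eZ.
case: (boolP (y \in W)) => [/imsetP[i _ yi]|yW]; last first.
  by rewrite eY lift_near_off // in YZ *; case: (cut_cap_regular yW) => ->.
case: (boolP (z \in W)) => [/imsetP[j _ zj]|zW]; last first.
  rewrite thirdsC; rewrite adj_sym in YZ.
  by rewrite eZ lift_near_off // in YZ *; case: (cut_cap_regular zW) => ->.
have [b eb] := lift_near_cycle x i; have [b' eb'] := lift_near_cycle x j.
rewrite yi eb in eY; rewrite zj eb' in eZ; rewrite eY eZ in YZ *.
by apply: copies_deg2; apply: adj_copies.
Qed.

(** Copies adjacent in T' are already adjacent in the cap: there are no chords between boundary
    vertices. *)
Lemma nonframe_interior X Y : adj T' X Y -> ~~ adj (cap V one) X Y ->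
  X \notin vertices (cap V one) \/ Y \notin vertices (cap V one).
Proof.
move=> XY nc; have /andP[nXY /existsP[k /andP[kT /andP[Xk Yk]]]] := XY.
case: (cut_cap_face kT) => [[f fT kE]|kc]; last first.
  by case/negP: nc; apply: adj_face kc Xk Yk nXY.
have O U : U \in k -> U \notin vertices (cap V one) \/ exists l, U = copy l.
  rewrite kE mem_cut_face => /andP[_ /eqP->].
  case: (lift_cases f (project U)) => [[i _ ->]|[_ ->]].
    by right; eexists.
  by left; apply: old_cap.
case: (O X Xk) => [|[[i b] eX]]; first by left.
case: (O Y Yk) => [|[[j b'] eY]]; first by right.
case/negP: nc; rewrite eX eY in XY *.
exact/consecutive_adj/adj_copies.
Qed.

Lemma cut_cap_contractible X Y : adj T' X Y -> ~~ adj (cap V one) X Y ->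
  contractible T' X Y -> cycles_facial T' X Y.
Proof.
move=> XY nc [_ tri _].
apply: (contract_cycles_facial cut_cap_only_triangles (adj_neq XY) XY _ _ tri).
  move=> Z XZ YZ; case: (nonframe_interior XY nc).
    case/(interior_old XY)=> x eX xW; rewrite eX in XY XZ YZ *.
    by split; [case: (cut_cap_regular xW) => -> | exact: near_deg2 XY XZ YZ].
  have YX : adj T' Y X by rewrite adj_sym.
  case/(interior_old YX)=> y eY yW; rewrite eY in YX YZ XZ *.
  by split; [exact: near_deg2 YX YZ XZ | case: (cut_cap_regular yW) => ->].
case: (nonframe_interior XY nc).
  by case/(interior_old XY)=> x -> xW; left; apply: (cut_cap_regular xW).2.
have YX : adj T' Y X by rewrite adj_sym.
by case/(interior_old YX)=> y -> yW; right; apply: (cut_cap_regular yW).2.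
Qed.

(** * Good edges and interior vertices before any contraction *)

Hypothesis nonfacial : forall x y, adj T x y -> ~~ cycles_facial T x y.

Local Notation path_between i X Y :=
  (edge_on_short_path T' (copy (i, false)) (copy (i, true)) X Y).

Lemma path_between_copies i b X Y :
  edge_on_short_path T' (copy (i, b)) (copy (i, ~~ b)) X Y -> path_between i X Y.
Proof.
case: b => [/= H|H]; last exact: H.
by apply: edge_on_short_path_rev H; apply/eqP=> /copy_inj[].
Qed.

Lemma near_edge_settled x y : x \notin W -> adj T x y ->
  cycles_facial T' (old x) (lift_near x y) ->
  exists i, path_between i (old x) (lift_near x y).
Proof.
move=> xW xy L; have [z [xz yz nf]] := cycles_facialPn (nonfacial xy).
have XY := near_adj xW xy; have XZ := near_adj xW xz.
(* Otherwise the 3-cycle xyz lifts to T', where it is facial, and it would be facial in T. *)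
have nYZ : ~ adj T' (lift_near x y) (lift_near x z).
  move=> YZ; case/negP: nf.
  have := cycles_facialP _ _ _ L _ XZ YZ.
  by case/near_face_inv=> _ +  _ _; rewrite !lift_nearK.
have copyN i b : copy (i, b) != copy (i, ~~ b).
  by apply/eqP=> /copy_inj[]; case: b.
have bN b b' : b' != b -> b' = ~~ b by case: b; case: b'.
have zy : adj T z y by rewrite adj_sym.
case: (boolP (y \in W)) => [/imsetP[i _ yi]|yW]; last first.
  have YZ := near_adj yW yz; rewrite (lift_near_off x yW) in XY nYZ *.
  case: (boolP (z \in W)) => [/imsetP[i _ zi]|zW]; last first.
    by case: nYZ; rewrite (lift_near_off x zW) -(lift_near_off y zW).
  (* As the 3-cycle does not lift, x and y see different copies of z = w_i, which x and y join by a
     path of length 3. *)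
  have [b eb] := lift_near_cycle x i; have [b' eb'] := lift_near_cycle y i.
  rewrite zi eb in XZ nYZ; rewrite zi eb' in YZ.
  have bb' : b' = ~~ b by apply: bN; apply: contra_notN nYZ => /eqP <-.
  exists i; apply: (@path_between_copies i b).
  exists [:: copy (i, b); old x; old y; copy (i, ~~ b)]; split.
    by apply: short_path3; rewrite // ?copyN // -?bb' // adj_sym.
  by rewrite !edge_on_cons !eqxx ?orbT.
case: (boolP (z \in W)) => [/imsetP[j _ zj]|zW]; last first.
  have [b eb] := lift_near_cycle x i; have [b' eb'] := lift_near_cycle z i.
  have ZY := near_adj zW zy; rewrite yi eb' in ZY.
  rewrite yi eb (lift_near_off x zW) in XY XZ nYZ *.
  have bb' : b' = ~~ b.
    by apply: bN; apply: contra_notN nYZ => /eqP <-; rewrite adj_sym.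
  exists i; apply: (@path_between_copies i b).
  exists [:: copy (i, b); old x; old z; copy (i, ~~ b)]; split.
    by apply: short_path3; rewrite // ?copyN // -?bb' // adj_sym.
  by rewrite !edge_on_cons !eqxx ?orbT.
(* Both y = w_i and z = w_j are on the cycle. The copies seen from x are not joined, so a boundary
   edge leads from this copy of w_j to the other copy of w_i. *)
have [b eb] := lift_near_cycle x i; have [b' eb'] := lift_near_cycle x j.
rewrite yi eb zj eb' in XY XZ nYZ yz *.
have ij : i != j by apply: contraTneq yz => ->; rewrite adj_irr.
have := consecutive_negb one b b' ij => /orP[C|C].
  by case: nYZ; apply/cap_adj/consecutive_adj.
exists i; apply: (@path_between_copies i b).
exists [:: copy (i, b); old x; copy (j, b'); copy (i, ~~ b)]; split.
  apply: short_path3; rewrite ?copyN //; first by rewrite adj_sym.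
    by rewrite adj_sym; apply/cap_adj/consecutive_adj.
  by apply: contraNneq ij => /copy_inj[->].
by rewrite !edge_on_cons !eqxx ?orbT.
Qed.

Lemma edges_settled_cut_cap : edges_settled (cap V one) copy T'.
Proof.
move=> X Y XY nc L; case: (nonframe_interior XY nc).
  case/(interior_old XY)=> x eX xW; rewrite eX in XY L *.
  have [_ xy eY] := near_adj_inv XY; rewrite eY in L *.
  exact: near_edge_settled.
have YX : adj T' Y X by rewrite adj_sym.
case/(interior_old YX)=> y eY yW; rewrite eY in YX L *.
have [_ yx eX] := near_adj_inv YX; rewrite eX cycles_facialC in L *.
have [i Hi] := near_edge_settled yW yx L.
by exists i; apply: edge_on_short_pathC.
Qed.

(** A vertex off the cycle sees a single copy because its star is not cut, and a boundary vertex by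
    the parity in [consecutive]. The apex t' of a one-sided cap is joined to all six copies. *)
Lemma not_both_copies Y i b : Y != t' -> adj T' Y (copy (i, b)) ->
  adj T' Y (copy (i, ~~ b)) -> False.
Proof.
case: Y => [[y|[j b']]|[]] // _.
  move=> /near_adj_inv[_ _ /= e1] /near_adj_inv[_ _ /= e2].
  by have := etrans e1 (esym e2) => /copy_inj[]; case: (b).
rewrite adj_sym => /adj_copies C1; rewrite adj_sym => /adj_copies.
exact: consecutive_unique C1.
Qed.

Lemma edge_on_short_path_vertex (F : {set {set cut_vertex V}}) (U U' X Y : cut_vertex V) :
  edge_on_short_path F U U' X Y -> vertex_on_short_path F U U' X.
Proof.
case=> q [sq /orP[] /mem_infix sub]; exists q; split=> //; apply: sub;
  by rewrite !inE eqxx ?orbT.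
Qed.

Lemma vertices_settled_cut_cap : vertices_settled (cap V one) copy T'.
Proof.
move=> X XT' Xc LX.
have S Y : adj T' X Y -> exists i, path_between i X Y.
  move=> XY; apply: edges_settled_cut_cap => //; last exact: LX.
  by apply: contra Xc; apply: adj_vertex.
have [Y0 XY0] : exists Y, adj T' X Y.
  case/bigcupP: XT' => k kT Xk.
  have [Y] : exists Y, Y \in k :\ X.
    apply/set0Pn; rewrite -card_gt0; move: (cut_cap_only_triangles kT).
    by rewrite (cardsD1 X) Xk => -[]; rewrite add0n => ->.
  by rewrite in_setD1 eq_sym => /andP[XY Yk]; exists Y; apply: adj_face kT Xk Yk XY.
have Xcopy k : X != copy k by apply: contraNneq Xc => ->; apply: copy_cap.
have uv i : copy (i, false) != copy (i, true) by apply/eqP=> /copy_inj[].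
have [i Pi] := S _ XY0; have Vi := edge_on_short_path_vertex Pi.
have [b Xb] : exists b, adj T' X (copy (i, b)).
  by have [||?|?] := vertex_on_short_path_adj (uv i) Vi; [| |exists false|exists true].
have [Y f] := adjP3 cut_cap_only_triangles _ _ Xb.
have [_ XY bY] := tri_adj cut_cap_only_triangles f.
have [j Pj] := S _ XY; have Vj := edge_on_short_path_vertex Pj.
case: (ltngtP i j) => [ij|ji|/ord_inj ij]; first by exists i, j.
  by exists j, i.
have Xt : X != t' by case/(interior_old XY0): Xc => x ->.
have Yt : Y != t'.
  case/(interior_old XY0): Xc => x eX _; rewrite eX in XY.
  by have [_ _ ->] := near_adj_inv XY; apply/eqP/lift_t.
have Yb : adj T' Y (copy (i, b)) by rewrite adj_sym.
have nX b1 b2 : adj T' X (copy (i, b1)) -> adj T' X (copy (i, b2)) -> b1 = b2.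
  by case: b1; case: b2 => // p q; case: (@not_both_copies X i false).
have nY b1 b2 : adj T' Y (copy (i, b1)) -> adj T' Y (copy (i, b2)) -> b1 = b2.
  by case: b1; case: b2 => // p q; case: (@not_both_copies Y i false).
(* Both X and Y are next to the b-copy of w_i, hence not to the other copy, so no short path between
   the two copies contains XY. *)
rewrite -{}ij in Pj; case: Pj => q [sq XYq]; exfalso.
case: (short_pathP (uv i) sq) XYq => [[_ ->]|[m [um mv ->]]|[m [n [[um mn nv] _ _ ->]]]];
  rewrite !edge_on_cons !edge_on1 !(negPf (Xcopy _)) /= ?orbF ?andbF //=.
  move=> H; have {H} Xm : X = m by case/orP: H => /andP[/eqP].
  by rewrite -Xm in um mv; rewrite adj_sym in um; have := nX _ _ um mv.
case/or4P=> /andP[/eqP Xm /eqP Yn].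
- rewrite -Xm adj_sym in um; have eb := nX _ _ Xb um.
  by rewrite Yn eb adj_irr in Yb.
- rewrite -Xm adj_sym in um; rewrite -Yn in nv.
  by have := etrans (esym (nX _ _ Xb um)) (nY _ _ Yb nv).
- rewrite -Xm in nv; rewrite -Yn adj_sym in um.
  by have := etrans (esym (nX _ _ Xb nv)) (nY _ _ Yb um).
rewrite -Xm in nv; have eb := nX _ _ Xb nv.
by rewrite Yn eb adj_irr in Yb.
Qed.

End CutCap.

(** * Sequences of contractions *)

Section Contractions.
Variables (V : finType) (K : {set {set V}}) (e : 'I_3 * bool -> V).
Hypotheses (e_inj : injective e) (eK : forall k, e k \in vertices K).

(** The second and third clauses need a special argument only for T'; after a contraction they hold
    because the result is a triangulation. *)
Definition settled (H : {set {set V}}) :=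
  [/\ only_triangles H,
      forall x y, adj H x y -> x \notin vertices K -> regular_at H x,
      forall x y, adj H x y -> ~~ adj K x y -> contractible H x y -> cycles_facial H x y,
      edges_settled K e H & vertices_settled K e H].

Lemma settled_contractions G H : contractions K G H -> settled G -> settled H.
Proof.
elim=> [//|{}G {}H a c _ IH /andP[_ aK] /andP[_ cK] con /IH[H3 R C E S]].
have [adjac tH' _] := con; have adjca : adj H c a by rewrite adj_sym.
have ra := R _ _ adjac aK; have rc := R _ _ adjca cK.
have lac : cycles_facial H a c.
  by apply: C con => //; apply: contra aK; apply: adj_vertex.
split.
- by case: tH'.
- by move=> x y _ _; apply: triangulation_regular.
- move=> x y xy _ [_ tri _].
  apply: (contract_cycles_facial _ (adj_neq xy) xy _ _ tri); first by case: tH'.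
    by move=> z xz yz; split; apply: (triangulation_regular _ tH').1.
  by left; apply: (triangulation_regular _ tH').2.
- exact: edges_settled_contract.
exact: vertices_settled_contract.
Qed.

End Contractions.

Theorem theorem4p2 (V : finType) (T : {set {set V}}) (w : 'I_3 -> V)
    (one : bool) (s : {set V} -> 'I_3 -> bool)
    (T'' : {set {set cut_vertex V}})
    (irrT : irreducible T)
    (not_sphere : ~ spherical T)
    (cycw : three_cycle T w)
    (nonsep : nonseparating T w)
    (sides : side_labelling T w one s)
    (contr : contractions (cap V one) (cut_cap T w one s) T'') :
  (forall x y : cut_vertex V, adj T'' x y ->
     [\/ adj (cap V one) x y,
         ~ contractible T'' x y
       | exists (i : 'I_3) (q : seq (cut_vertex V)),
           short_path T'' (u' i) (v' i) q /\ edge_on x y q]) /\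
  (forall x : cut_vertex V, x \in vertices T'' ->
     [\/ x \in vertices (cap V one),
         exists y : cut_vertex V, adj T'' x y /\ ~ contractible T'' x y
       | exists i j : 'I_3, i < j /\
           (exists q : seq (cut_vertex V),
              short_path T'' (u' i) (v' i) q /\ x \in q) /\
           (exists q : seq (cut_vertex V),
              short_path T'' (u' j) (v' j) q /\ x \in q)]).
Proof.
have [tT irr] := irrT.
have nonfacial x y : adj T x y -> ~~ cycles_facial T x y.
  by move=> xy; apply/negP=> L; apply: (irr x y); apply: cycles_facial_contractible.
have S' : settled (cap V one) (@copy V) (cut_cap T w one s).
  split.
  - exact: cut_cap_only_triangles.
  - move=> x y xy xK; have [x0 -> x0W] := interior_old tT cycw sides xy xK.
    exact: cut_cap_regular.
  - exact: cut_cap_contractible.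
  - exact: edges_settled_cut_cap.
  exact: vertices_settled_cut_cap.
have [_ _ C E S] := settled_contractions (@copy_inj V) (@copy_cap V one) contr S'.
split=> [x y xy|x xT].
  case: (boolP (adj (cap V one) x y)) => [|nc]; first by constructor 1.
  case: (boolP (cycles_facial T'' x y)) => [L|nL].
    by constructor 3; apply: E.
  by constructor 2 => con; case/negP: nL; apply: C.
case: (boolP (x \in vertices (cap V one))) => [|xK]; first by constructor 1.
case: (boolP [forall y, adj T'' x y ==> cycles_facial T'' x y]) => [/forallP L|].
  by constructor 3; apply: S => // y; apply/implyP.
rewrite negb_forall => /existsP[y]; rewrite negb_imply => /andP[xy nL].
constructor 2; exists y; split=> // con; case/negP: nL; apply: C => //.
by apply: contra xK; apply: adj_vertex.
Qed.
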